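(* Let $s,t\ge 2$ be integers. Then there exists $\ell_0$ such that for all $\ell\ge \ell_0$, $$\mathrm{ex}\big(n,D^{\ell}_{t-1,s-1}\big)=\Theta\big(n^{2-\frac{t}{st-1}}\big).$$
   Context: $\mathrm{ex}(n,F)$ is the maximum number of edges in an $n$-vertex graph with no subgraph isomorphic to $F$. For $s,t\in\mathbb N$, $D_{t,s}$ is the tree obtained from a star with $t$ edges by attaching $s$ new pendant leaves to each of its $t+1$ vertices, rooted on its leaves. For a rooted graph $(F,R)$ and $\ell\in\mathbb N$, the blow-up $F^\ell$ is obtained from $\ell$ vertex-disjoint copies of $F$ by identifying, for each root $v\in R$, the $\ell$ copies of $v$ into one vertex. *)

(* Defs.v *)
From mathcomp Require Import all_boot.
From Stdlib Require Import Reals.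
Set Implicit Arguments. Unset Strict Implicit. Unset Printing Implicit Defensive.

Definition simple_graph (n : nat) (g : {ffun 'I_n * 'I_n -> bool}) : bool :=
  [forall x, ~~ g (x, x)] && [forall x, forall y, g (x, y) == g (y, x)].

Definition nedges (n : nat) (g : {ffun 'I_n * 'I_n -> bool}) : nat :=
  #|[set p : 'I_n * 'I_n | g p && (p.1 < p.2)]|.

Definition contains (T : finType) (eF : rel T) (n : nat)
    (g : {ffun 'I_n * 'I_n -> bool}) : bool :=
  [exists f : {ffun T -> 'I_n},
     injectiveb f && [forall x, forall y, eF x y ==> g (f x, f y)]].

Definition ex (T : finType) (eF : rel T) (n : nat) : nat :=
  \max_(g : {ffun 'I_n * 'I_n -> bool} | simple_graph g && ~~ contains eF g)
     nedges g.

(* The tree D_{t,s}: a star with centre None and leaves Some i (i < t);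
   each of the t+1 star vertices u gets s pendant leaves (u, j), j < s. *)
Definition Dvert (t s : nat) : finType := (option 'I_t + (option 'I_t * 'I_s))%type.

Definition Dedge (t s : nat) : rel (Dvert t s) := fun x y =>
  match x, y with
  | inl None, inl (Some _) | inl (Some _), inl None => true
  | inl u, inr (v, _) | inr (v, _), inl u => u == v
  | _, _ => false
  end.

Definition leaves (T : finType) (e : rel T) : {set T} :=
  [set v | #|[set w | e v w]| == 1].

(* Blow-up F^l of a rooted graph (F, R): l disjoint copies (v, i), i < l, with the
   copies of each root identified (the root is represented by its copy with i = 0). *)
Definition blowup_vert (T : finType) (R : {set T}) (l : nat) : finType :=
  {p : T * 'I_l | (p.1 \in R) ==> (val p.2 == 0)}.

Definition blowup_edge (T : finType) (e : rel T) (R : {set T}) (l : nat)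
    : rel (blowup_vert R l) := fun x y =>
  e (val x).1 (val y).1 &&
  [|| (val x).2 == (val y).2, (val x).1 \in R | (val y).1 \in R].

Definition Dblow (t s l : nat) : rel (blowup_vert (leaves (@Dedge t s)) l) :=
  @blowup_edge _ (@Dedge t s) (leaves (@Dedge t s)) l.

(* Main.v *)
(** Write [s = r + 1] and [t = k + 1], so that the tree has [k + 1] inner vertices, [r] roots
    attached to each of them, and [b = (k + 1) r + k] edges.

    Upper bound.  Pass to a subgraph of minimum degree [d] and weight the copies of the tree by the
    tree-indexed stationary random walk; then every star of the tree has the same law, without any
    regularity assumption.  Call a star with [r + 1] leaves heavy if its leaves have at least a large
    constant (weighted) codegree.  If heavy stars are rare, a typical copy contains none; on some tuple
    of roots there are then many such copies while each vertex lies in few of them, and disjoint copies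
    are chosen greedily.  If heavy stars are not rare, convexity makes heavy sets positively dense
    inside the common neighbourhood [N] of some [r]-set, which serves as the roots of the centre:
    the other roots and the centres are chosen in [N], and the satellites greedily.

    Lower bound.  Join two copies of [F_q^b] by the common zeros of [k + 1] random polynomials of bounded
    degree.  For given roots, the copies of the tree solve as many equations as there are unknowns.
    At most a constant number of solutions is nonsingular (Bezout), and each singular one costs an extra
    factor [1/q], since values and gradients of a random polynomial at boundedly many points are
    independent.  Hence a long list of disjoint singular copies on common roots has such a small
    probability that a union bound over the roots excludes it; no point count on varieties is needed. *)

From Stdlib Require Import Reals.
From mathcomp Require Import all_boot all_order all_algebra all_field.
From mathcomp Require Import ring lra zify.
Require Import Defs.
Set Implicit Arguments. Unset Strict Implicit. Unset Printing Implicit Defensive.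
Import Order.TTheory GRing.Theory Num.Theory.

Lemma leq_expl (a b m : nat) : a <= b -> a ^ m <= b ^ m.
Proof. by move=> ab; elim: m => // m IH; rewrite !expnS leq_mul. Qed.

(** Here [g] places the roots, which all copies share, and [X j u] is the inner vertex [u] of copy
    [j]. This form makes sense for any finite vertex type, so it passes to induced subgraphs and to
    algebraic graphs; [contains_blowup] links it to [contains]. *)
Definition blowup_embedding (V : finType) (e : rel V) (k r l : nat) : Prop :=
  exists (g : option 'I_k * 'I_r -> V) (X : 'I_l -> option 'I_k -> V),
    [/\ injective g,
        forall j u j' u', X j u = X j' u' -> j = j' /\ u = u',
        forall j u a, X j u <> g a,
        forall j u i, e (X j u) (g (u, i))
      & forall j i, e (X j None) (X j (Some i))].

Local Open Scope ring_scope.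

Lemma prod_natb (R : realFieldType) (I : finType) (P : I -> bool) :
  \prod_i (P i)%:R = [forall i, P i]%:R :> R.
Proof.
have [/forallP h|] := boolP [forall i, P i]; first by rewrite big1 // => i _; rewrite h.
by rewrite negb_forall => /existsP[i /negPf h]; rewrite (bigD1 i) //= h mul0r.
Qed.

(** * Sums over product weights *)

Section ProductWeights.
Variables (R : realFieldType) (J T : finType).
Implicit Types (p : J -> T -> R) (g : {ffun J -> T}).

Lemma sum_prod_ffun p : \sum_(g : {ffun J -> T}) \prod_j p j (g j) = \prod_j \sum_v p j v.
Proof. by rewrite bigA_distr_bigA. Qed.

Lemma sum_prod_ffun_at p (j0 : J) (h : T -> R) :
  (forall j, j != j0 -> \sum_v p j v = 1) ->
  \sum_(g : {ffun J -> T}) h (g j0) * \prod_j p j (g j) = \sum_v h v * p j0 v.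
Proof.
move=> p1.
(* Absorbing [h] into the factor at [j0] restores a pure product, so the sum factors. *)
pose p' j v := (if j == j0 then h v else 1) * p j v.
transitivity (\sum_(g : {ffun J -> T}) \prod_j p' j (g j)).
  apply: eq_bigr => g _; rewrite big_split /=; congr (_ * _).
  rewrite (bigD1 j0) //= eqxx big1 ?mulr1 // => j /negPf -> //.
rewrite sum_prod_ffun (bigD1 j0) //= [X in _ * X]big1 ?mulr1.
  by apply: eq_bigr => v _; rewrite /p' eqxx.
move=> j jN; rewrite -[RHS](p1 j jN); apply: eq_bigr => v _.
by rewrite /p' (negPf jN) mul1r.
Qed.

(** For a common value [v], the coordinate [j'] contributes [p j' v <= m], while [j] still sums
    freely; hence only the factor of [j'] is replaced by [m]. *)
Lemma sum_coincide p (j j' : J) (m : R) : j != j' ->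
  (forall k v, 0 <= p k v) -> (forall v, p j' v <= m) ->
  \sum_(g : {ffun J -> T} | g j == g j') \prod_k p k (g k)
    <= m * \prod_(k | k != j') \sum_v p k v.
Proof.
move=> jj' p0 pm.
(* The indicators pin both coordinates to [v], which turns the event [g j = g j'] into a sum of
   product weights. *)
pose q v k u := (if (k == j) || (k == j') then (u == v)%:R else 1) * p k u : R.
have -> : \sum_(g : {ffun J -> T} | g j == g j') \prod_k p k (g k)
        = \sum_v \sum_(g : {ffun J -> T}) \prod_k q v k (g k).
  rewrite exchange_big /= big_mkcond; apply: eq_bigr => g _.
  have qE v : \prod_k q v k (g k) = ((g j == v) && (g j' == v))%:R * \prod_k p k (g k).
    rewrite /q big_split /=; congr (_ * _).
    rewrite (bigD1 j) //= eqxx (bigD1 j') /=; last by rewrite eq_sym.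
    rewrite eqxx orbT big1 ?mulr1; last by move=> k /andP[/negPf -> /negPf ->].
    by rewrite -natrM mulnb.
  rewrite (eq_bigr _ (fun v _ => qE v)).
  rewrite (bigD1 (g j)) //= [X in _ + X]big1 ?addr0; last first.
    by move=> v /negPf gN; rewrite eq_sym gN mul0r.
  by rewrite eqxx /= eq_sym; case: eqP => _; rewrite ?mul1r ?mul0r.
rewrite (bigD1 j) //= mulr_suml mulr_sumr; apply: ler_sum => v _.
rewrite sum_prod_ffun (bigD1 j) //= [X in _ * X](bigD1 j') /=; last by rewrite eq_sym.
have E k : (k == j) || (k == j') -> \sum_u q v k u = p k v.
  move=> kj; rewrite (bigD1 v) //= big1; first by rewrite /q kj eqxx mul1r addr0.
  by move=> u /negPf uv; rewrite /q kj uv mul0r.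
rewrite !E ?eqxx ?orbT //.
have -> : \prod_(i | (i != j) && (i != j')) \sum_v0 q v i v0 =
   \prod_(k | (k != j') && (k != j)) \sum_v0 p k v0.
  apply: eq_big => [k|k /andP[/negPf kj /negPf kj']]; first by rewrite andbC.
  by apply: eq_bigr => u _; rewrite /q kj kj' mul1r.
rewrite mulrCA; apply: ler_wpM2r; last exact: pm.
by apply: mulr_ge0 => //; apply: prodr_ge0 => k _; apply: sumr_ge0.
Qed.

(** Union bound over the ordered pairs of coordinates that may collide. *)
Lemma sum_noninjective p (m B : R) :
  (forall k v, 0 <= p k v) -> (forall j v, p j v <= m) ->
  (forall j, \prod_(k | k != j) \sum_v p k v <= B) -> 0 <= m ->
  \sum_(g : {ffun J -> T} | ~~ injectiveb g) \prod_k p k (g k)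
    <= (#|J| ^ 2)%:R * (m * B).
Proof.
move=> p0 pm pB m0.
have P0 g : 0 <= \prod_k p k (g k) by apply: prodr_ge0.
apply: (@le_trans _ _ (\sum_j \sum_(j' | j != j')
   \sum_(g : {ffun J -> T} | g j == g j') \prod_k p k (g k))).
  under [leRHS]eq_bigr do rewrite (exchange_big_dep xpredT) //=.
  rewrite exchange_big /= big_mkcond; apply: ler_sum => g _.
  case: ifP => [/injectivePn[j [j' jj' gE]]|_]; last first.
    by apply: sumr_ge0 => j _; apply: sumr_ge0.
  rewrite [leRHS](bigD1 j) //= [X in _ <= X + _](bigD1 j') /=; last by rewrite jj' gE eqxx.
  rewrite -addrA lerDl addr_ge0 ?sumr_ge0 // => i _; exact: sumr_ge0.
have -> : (#|J| ^ 2)%:R * (m * B) = \sum_(j : J) \sum_(j' : J) (m * B).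
  by rewrite !sumr_const -mulrnA mulr_natl mulnn.
apply: ler_sum => j _; rewrite [leRHS](bigID (fun j' => j != j')) /=.
have mB : 0 <= m * B.
  apply: mulr_ge0 => //; apply: le_trans (pB j).
  by apply: prodr_ge0 => k _; apply: sumr_ge0.
rewrite -[leLHS]addr0; apply: lerD; last exact: sumr_ge0.
apply: ler_sum => j' jj'; apply: le_trans (sum_coincide jj' p0 (pm j')) _.
exact: ler_wpM2l.
Qed.
End ProductWeights.

Lemma sum_prod_ffun_eq (R : realFieldType) (J T : finType) (q : J -> T -> R) (j0 : J) (v : T) :
  \sum_(g : {ffun J -> T} | g j0 == v) \prod_j q j (g j)
    = q j0 v * \prod_(j | j != j0) \sum_u q j u.
Proof.
pose q' j u := (if j == j0 then (u == v)%:R else 1) * q j u : R.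
transitivity (\sum_(g : {ffun J -> T}) \prod_j q' j (g j)).
  rewrite big_mkcond; apply: eq_bigr => g _.
  rewrite /q' big_split /= [X in _ = X * _](bigD1 j0) //= eqxx [X in _ * X * _]big1; last first.
    by move=> j /negPf ->.
  by case: eqP; rewrite ?mulr1 ?mul1r ?mul0r.
rewrite sum_prod_ffun (bigD1 j0) //=; congr (_ * _).
  rewrite (bigD1 v) //= big1 ?addr0; last by move=> u /negPf uv; rewrite /q' eqxx uv mul0r.
  by rewrite /q' !eqxx mul1r.
by apply: eq_bigr => j /negPf jN; apply: eq_bigr => u _; rewrite /q' jN mul1r.
Qed.

Definition row_of (U V : finType) (r : nat) (g : {ffun U * 'I_r -> V}) (u : U)
  : {ffun 'I_r -> V} := [ffun j => g (u, j)].

Lemma sum_rows (R : realFieldType) (U V : finType) (r : nat)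
    (F : {ffun U -> {ffun 'I_r -> V}} -> R) :
  \sum_(g : {ffun U * 'I_r -> V}) F [ffun u => row_of g u] = \sum_g F g.
Proof.
rewrite [RHS](reindex (fun g : {ffun U * 'I_r -> V} => [ffun u => row_of g u])) //.
exists (fun h : {ffun U -> {ffun 'I_r -> V}} => [ffun a => h a.1 a.2]) => [g _|h _].
  by apply/ffunP => -[u j]; rewrite !ffunE.
by apply/ffunP => u; apply/ffunP => j; rewrite !ffunE.
Qed.

(** * Greedy choices *)

(** If every admissible choice met a vertex used before, charging each choice to such a vertex would
    bound the total weight by the number of used vertices times [Om], against the last hypothesis.
    So one more disjoint choice always exists. *)
Lemma greedy_disjoint (R : realFieldType) (V M : finType) (P : pred M) (om : M -> R)
    (occ : M -> {set V}) (Om : R) (Z0 : {set V}) (l c : nat) :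
  0 <= Om -> (forall m, 0 <= om m) -> (forall m, #|occ m| <= c)%N ->
  (forall v, \sum_(m | P m && (v \in occ m)) om m <= Om) ->
  (#|Z0| + l * c)%:R * Om < \sum_(m | P m) om m ->
  exists x : 'I_l -> M,
    [/\ forall j, P (x j), forall j, [disjoint occ (x j) & Z0]
      & forall j j', j != j' -> [disjoint occ (x j) & occ (x j')]].
Proof.
move=> Om0 om0 occ_c omO; elim: l => [|l IH] tot.
  exists (fun j : 'I_0 => match j with Ordinal _ h => False_rect M (notF h) end).
  by split=> -[].
have [|x [xP xZ xx]] := IH.
  apply: le_lt_trans tot; rewrite ler_wpM2r ?ler_nat ?leq_add2l ?leq_mul //.
pose Z := Z0 :|: \bigcup_j occ (x j).
have Zcard : (#|Z| <= #|Z0| + l.+1 * c)%N.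
  apply: leq_trans (leq_card_setU _ _) _; rewrite leq_add2l.
  apply: (@leq_trans (l * c)%N); last by rewrite leq_mul.
  rewrite -[l in (l * c)%N]card_ord -sum_nat_const.
  apply: leq_trans (_ : \sum_j #|occ (x j)| <= _)%N; last exact: leq_sum.
  elim/big_rec2: _ => [|j a B _ IHB]; first by rewrite cards0.
  by apply: leq_trans (leq_card_setU _ _) _; rewrite leq_add2l.
have [m /andP[Pm mZ]|noM] := pickP (fun m => P m && [disjoint occ m & Z]).
  have mZ0 : [disjoint occ m & Z0] by apply: disjointWr mZ; apply: subsetUl.
  have mx j : [disjoint occ m & occ (x j)].
    apply: disjointWr mZ; apply: subset_trans (subsetUr _ _).
    exact: (bigcup_sup j).
  exists (fun j => if unlift ord_max j is Some j' then x j' else m).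
  split=> [j|j|j j'].
  - by case: unliftP.
  - by case: unliftP.
  - case: unliftP => [i ->|->]; case: unliftP => [i' ->|->] // ii'.
    + by apply: xx; apply: contraNneq ii' => ->.
    + by rewrite disjoint_sym.
    + by rewrite eqxx in ii'.
suff : \sum_(m | P m) om m <= (#|Z0| + l.+1 * c)%:R * Om by rewrite leNgt tot.
apply: (@le_trans _ _ (\sum_(v in Z) \sum_(m | P m && (v \in occ m)) om m)).
  rewrite (exchange_big_dep P) /=; last by move=> v m _ /andP[].
  apply: ler_sum => m Pm; have /negbT := noM m; rewrite Pm /=.
  rewrite disjoint_sym disjoint_subset => /subsetPn[v vZ]; rewrite !inE negbK => vm.
  rewrite (bigD1 v) /=; last by rewrite vZ vm.
  by rewrite lerDl sumr_ge0.
apply: le_trans (ler_sum _ (fun v _ => omO v)) _.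
by rewrite sumr_const -[leLHS]mulr_natl ler_wpM2r // ler_nat.
Qed.

Lemma greedy_representatives (V I : finType) (A : I -> {set V}) (Z : {set V}) :
  (forall i, #|Z| + #|I| <= #|A i|)%N ->
  exists y : I -> V, [/\ injective y, forall i, y i \in A i & forall i, y i \notin Z].
Proof.
move=> cardA.
(* Induction over lists of indices: the representatives chosen so far together with [Z] never
   exhaust the next set. *)
suff H (s : seq I) : (size s <= #|I|)%N -> uniq s ->
    exists2 y : seq V, size y = size s & uniq y /\
      forall i v, (i, v) \in zip s y -> v \in A i :\: Z.
  have [|y sy [uy yA]] := H (enum I) _ (enum_uniq _); first by rewrite -cardE.
  have sI i : (index i (enum I) < size y)%N by rewrite sy index_mem mem_enum.
  have [i0 _|I0] := pickP I; last by exists (fun i =>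
    False_rect V (Bool.diff_true_false (I0 i))); split=> i; have := I0 i.
  have [v0 _] : exists v0, v0 \in A i0.
    by apply/card_gt0P; apply: leq_trans (cardA i0); rewrite addn_gt0 orbC; apply/orP; left;
      apply/card_gt0P; exists i0.
  have yAi i : nth v0 y (index i (enum I)) \in A i :\: Z.
    apply: yA; have -> : (i, nth v0 y (index i (enum I)))
      = nth (i, v0) (zip (enum I) y) (index i (enum I)).
      by rewrite nth_zip // nth_index // mem_enum.
    by apply: mem_nth; rewrite size_zip -sy minnn.
  exists (fun i => nth v0 y (index i (enum I))); split.
  - move=> i j /eqP; rewrite nth_uniq // => /eqP ij.
    by rewrite -(nth_index i (mem_enum I i)) ij nth_index // mem_enum.
  - by move=> i; have := yAi i; rewrite inE => /andP[].
  - by move=> i; have := yAi i; rewrite inE => /andP[].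
elim: s => [|i s IH] /= ss; first by exists [::].
case/andP=> _ us; have [|y sy [uy yA]] := IH _ us; first exact: ltnW.
have /card_gt0P[v] : (0 < #|A i :\: (Z :|: [set v in y])|)%N.
  rewrite cardsD subn_gt0; apply: leq_ltn_trans (subset_leq_card (subsetIr _ _)) _.
  apply: leq_ltn_trans (leq_card_setU _ _) _; apply: leq_trans (cardA i).
  rewrite -addnS leq_add2l cardsE; apply: leq_ltn_trans (card_size _) _; by rewrite sy.
rewrite !inE negb_or => /andP[/andP[vZ vy] vA].
exists (v :: y); rewrite /= ?sy ?vy //; split=> // j u.
rewrite inE => /orP[/eqP[-> ->]|]; last exact: yA.
by rewrite inE vZ vA.
Qed.

(** Double counting of pairs of a [k]-tuple of rows in [N] and a vertex related to all its rows.
    Many vertices are related to a positive proportion of all rows, so the count has the full order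
    of magnitude, and some injective tuple must serve more than [m] vertices. *)
Lemma dense_relation (R : realFieldType) (V : finType) (N : {set V}) (r k m Q : nat)
    (H : V -> {ffun 'I_r -> V} -> bool) : (0 < k * r)%N -> (0 < Q)%N ->
  #|N|%:R ^+ r.+1 <= Q%:R * \sum_(x in N) \sum_(S : {ffun 'I_r ->
    V} | [forall j, S j \in N]) (H x S)%:R :> R ->
  ((2 * Q) ^ k.+1 * (m + (k * r) ^ 2) < #|N|)%N ->
  exists S : {ffun 'I_k * 'I_r -> V},
    [/\ injective S, forall a, S a \in N
      & (m < #|[set x in N | [forall i, H x (row_of S i)]]|)%N].
Proof.
move=> kr_gt0 Q_gt0 dense N_big; pose M : R := #|N|%:R.
have M_gt0 : 0 < M by rewrite ltr0n (leq_trans _ N_big).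
have Q0 : 0 < Q%:R :> R by rewrite ltr0n.
pose X (S : {ffun 'I_k * 'I_r -> V}) := [set x in N | [forall i, H x (row_of S i)]].
have [/existsP[S /and3P[/injectiveP h1 /forallP h2 h3]]|] :=
    boolP [exists S : {ffun 'I_k * 'I_r -> V},
      [&& injectiveb S, [forall a, S a \in N] & (m < #|X S|)%N]].
  by exists S.
rewrite negb_exists => /forallP no; exfalso.
pose h x : R := \sum_(S : {ffun 'I_r -> V}) (\prod_j (S j \in N)%:R) * (H x S)%:R.
have h_ge0 x : 0 <= h x.
  by apply: sumr_ge0 => S _; rewrite mulr_ge0 ?ler0n // prodr_ge0 // => j _; apply: ler0n.
have hE x : h x = \sum_(S : {ffun 'I_r -> V} | [forall j, S j \in N]) (H x S)%:R.
  rewrite [RHS]big_mkcond; apply: eq_bigr => S _; rewrite prod_natb.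
  by case: ifP; rewrite ?mul1r ?mul0r.
have sumN : \sum_v (v \in N)%:R = M :> R.
  by rewrite /M -sum1_card natr_sum [RHS]big_mkcond; apply: eq_bigr => v _; case: (v \in N).
have h_le x : h x <= M ^+ r.
  have -> : M ^+ r = \sum_(S : {ffun 'I_r -> V}) \prod_j (S j \in N)%:R.
    by rewrite (sum_prod_ffun (fun _ v => (v \in N)%:R)) sumN prodr_const card_ord.
  apply: ler_sum => S _; apply: ler_piMr; first by apply: prodr_ge0 => j _; apply: ler0n.
  by case: (H x S); rewrite ?ler01.
pose tot := \sum_(S : {ffun 'I_k * 'I_r -> V}) (\prod_a (S a \in N)%:R) * #|X S|%:R : R.
have totE : tot = \sum_(x in N) h x ^+ k.
  have hk x : h x ^+ k = \sum_(S : {ffun 'I_k * 'I_r -> V})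
      (\prod_a (S a \in N)%:R) * [forall i, H x (row_of S i)]%:R.
    have -> : h x ^+ k = \prod_(i < k) h x by rewrite prodr_const card_ord.
    rewrite /h -(sum_prod_ffun (fun (_ : 'I_k) (S : {ffun 'I_r -> V}) =>
      (\prod_j (S j \in N)%:R) * (H x S)%:R)).
    rewrite -(sum_rows (fun g : {ffun 'I_k -> {ffun 'I_r -> V}} =>
      \prod_i ((\prod_j (g i j \in N)%:R) * (H x (g i))%:R))).
    apply: eq_bigr => S _; rewrite big_split /= -prod_natb pair_big /=; congr (_ * _).
      by apply: eq_bigr => -[i j] _; rewrite !ffunE.
    by apply: eq_bigr => i _; rewrite ffunE.
  under [RHS]eq_bigr => x _ do rewrite hk.
  rewrite exchange_big /=; apply: eq_bigr => S _; rewrite -mulr_sumr; congr (_ * _).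
  rewrite -sum1_card natr_sum big_mkcond [RHS]big_mkcond.
  by apply: eq_bigr => x _; rewrite inE; case: (x \in N) => //=; case: [forall _, _].
(* If no good tuple exists, each injective tuple counts at most [m] vertices, while the tuples with
   a repetition number at most [(k * r) ^ 2 * M ^+ (k * r).-1] and count at most [M] each. *)
have tot_le : tot <= (m + (k * r) ^ 2)%:R * M ^+ (k * r).
  have -> : M ^+ (k * r) = \sum_(S : {ffun 'I_k * 'I_r -> V}) \prod_a (S a \in N)%:R.
    by rewrite (sum_prod_ffun (fun _ v => (v \in N)%:R)) sumN prodr_const card_prod !card_ord.
  apply: (@le_trans _ _ (\sum_(S : {ffun 'I_k * 'I_r -> V}) m%:R * (\prod_a (S a \in N)%:R) +
     M * \sum_(S : {ffun 'I_k * 'I_r -> V} | ~~ injectiveb S) (\prod_a (S a \in N)%:R))).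
    rewrite mulr_sumr [X in _ <= _ + X]big_mkcond -big_split /=; apply: ler_sum => S _.
    have P0 : 0 <= \prod_a (S a \in N)%:R :> R by rewrite prod_natb ler0n.
    case: ifP => [_|/negbFE inj].
      apply: ler_wpDl; first by rewrite mulr_ge0 ?ler0n.
      rewrite mulrC ler_wpM2r // ler_nat subset_leq_card //.
      by apply/subsetP => x; rewrite inE => /andP[].
    have := no S; rewrite inj /= addr0 prod_natb; case: [forall a, _] => /=;
      last by rewrite mul0r mulr0.
    by rewrite -leqNgt mul1r mulr1 ler_nat.
  rewrite -mulr_sumr natrD mulrDl lerD2l.
  have := @sum_noninjective R ('I_k * 'I_r)%type V (fun _ v =>
    (v \in N)%:R) 1 (M ^+ (k * r).-1) _ _ _ _.
  rewrite card_prod !card_ord mul1r => HH; apply: le_trans (ler_wpM2l (ltW M_gt0) (HH _ _ _ _)) _.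
  - by move=> *; apply: ler0n.
  - by move=> _ v; case: (v \in N); rewrite ?ler01.
  - move=> a; under eq_bigr do rewrite sumN; rewrite prodr_const.
    have := cardC1 a; rewrite card_prod !card_ord => <-.
    by rewrite le_eqVlt; apply/orP; left; apply/eqP; congr (_ ^+ _); apply: eq_card => i;
      rewrite !inE.
  - exact: ler01.
  rewrite mulrCA -exprS prednK // (sum_prod_ffun (fun _ v => (v \in N)%:R)) sumN prodr_const.
  by rewrite card_prod !card_ord.
pose Q2 : R := (2 * Q)%:R; have Q2_gt0 : 0 < Q2 by rewrite ltr0n muln_gt0.
have tot_ge : M ^+ (k * r).+1 <= Q2 ^+ k.+1 * tot.
  (* The vertices reaching half of the average density: the others account for at most half of the
     sum in [dense], so [X'] has at least [M / Q2] elements. *)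
  pose X' := [set x in N | M ^+ r <= Q2 * h x].
  have X'_big : M <= Q2 * #|X'|%:R.
    have : M ^+ r.+1 <= Q%:R * (#|X'|%:R * M ^+ r + M * (M ^+ r / Q2)).
      apply: le_trans dense _; apply: ler_wpM2l; first exact: ltW.
      rewrite (eq_bigr h); last by move=> x _; rewrite hE.
      rewrite (bigID (mem X')) /=; apply: lerD.
        rewrite mulr_natl -sumr_const [X in X <= _]big_mkcond [X in _ <= X]big_mkcond;
          apply: ler_sum => x _.
        by rewrite !inE; case: (x \in N) => //=; case: ifP.
      rewrite mulr_natl -sumr_const [X in X <= _]big_mkcond [X in _ <= X]big_mkcond;
        apply: ler_sum => x _.
      have p0 : 0 <= M ^+ r / Q2 by rewrite divr_ge0 ?exprn_ge0 // ltW.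
      rewrite !inE; case: (x \in N) => //=; case: ifP => //; rewrite -ltNge => /ltW.
      by rewrite ler_pdivlMr // mulrC.
    rewrite exprS; have Mr : 0 < M ^+ r by rewrite exprn_gt0.
    have -> : Q%:R * (#|X'|%:R * M ^+ r + M * (M ^+ r / Q2)) = (Q%:R * #|X'|%:R + M / 2) * M ^+ r.
      by rewrite /Q2 natrM; field; rewrite gt_eqF.
    by rewrite ler_pM2r // /Q2 natrM; lra.
  have -> : Q2 ^+ k.+1 * tot = Q2 * (Q2 ^+ k * tot) by rewrite exprS mulrA.
  apply: le_trans (_ : Q2 * #|X'|%:R * M ^+ (k * r) <= _).
    by rewrite exprS ler_wpM2r // exprn_ge0 // ltW.
  rewrite -mulrA ler_pM2l // totE mulr_sumr mulr_natl -sumr_const [X in X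
    <= _]big_mkcond [X in _ <= X]big_mkcond.
  apply: ler_sum => x _; rewrite !inE; case: (x \in N) => //=; case: ifP => hx; last first.
    by rewrite mulr_ge0 ?exprn_ge0 // ltW.
  by rewrite -exprMn mulnC exprM lerXn2r ?nnegrE ?mulr_ge0 ?exprn_ge0 // ltW.
have : M ^+ (k * r).+1 <= Q2 ^+ k.+1 * ((m + (k * r) ^ 2)%:R * M ^+ (k * r)).
  by apply: le_trans tot_ge _; rewrite ler_wpM2l // exprn_ge0 // ltW.
rewrite exprS mulrA ler_pM2r ?exprn_gt0 // -natrX -natrM ler_nat leqNgt; by rewrite N_big.
Qed.

(** * Upper bound: heavy and light stars *)

Section Weights.
Variables (R : realFieldType) (V : finType) (e : rel V) (d r k L l : nat).
Hypotheses (e_sym : symmetric e) (e_irr : irreflexive e) (d_gt0 : (0 < d)%N).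
Hypotheses (r_gt0 : (0 < r)%N) (k_gt0 : (0 < k)%N).
Hypothesis (deg_ge : forall x, (d <= #|[set y | e x y]|)%N).
Notation T := {ffun 'I_r -> V}.
Notation U := (option 'I_k).

Definition wdeg (x : V) : R := #|[set y | e x y]|%:R.
Definition adj (x y : V) : R := (e x y)%:R.
Definition stepw (x y : V) : R := adj x y / wdeg x.
Definition tuplew (y : V) (S : T) : R := \prod_j stepw y (S j).
(** Weighted number of common neighbours [y] of [x] and all entries of [S], each counted with weight
    [wdeg y ^- r]. It is the weight of the stars with leaves [x] and [S] after summing over the
    star's centre. *)
Definition codegw (x : V) (S : T) : R := \sum_y adj y x * tuplew y S.
Definition vol : R := \sum_x wdeg x.

Lemma wdeg_ge x : d%:R <= wdeg x. Proof. by rewrite ler_nat. Qed.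
Lemma wdeg_gt0 x : 0 < wdeg x. Proof. by rewrite ltr0n (leq_trans d_gt0). Qed.
Lemma adj_ge0 x y : 0 <= adj x y. Proof. exact: ler0n. Qed.
Lemma adjC x y : adj x y = adj y x. Proof. by rewrite /adj e_sym. Qed.

Lemma sum_adj x : \sum_y adj x y = wdeg x.
Proof.
by rewrite /adj -natr_sum /wdeg -sum1dep_card [in RHS]big_mkcond.
Qed.

Lemma stepw_ge0 x y : 0 <= stepw x y.
Proof. by rewrite divr_ge0 ?adj_ge0 ?ler0n. Qed.

Lemma stepw_le x y : stepw x y <= d%:R^-1.
Proof.
rewrite /stepw; apply: (@le_trans _ _ (wdeg x)^-1).
  by rewrite ler_piMl ?invr_ge0 ?ler0n // /adj; case: e; rewrite ?ler01.
by rewrite lef_pV2 ?wdeg_ge // posrE ?wdeg_gt0 ?ltr0n.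
Qed.

Lemma sum_stepw x : \sum_y stepw x y = 1.
Proof. by rewrite -mulr_suml sum_adj divff // gt_eqF ?wdeg_gt0. Qed.

Lemma tuplew_ge0 y S : 0 <= tuplew y S.
Proof. by apply: prodr_ge0 => j _; apply: stepw_ge0. Qed.

Lemma sum_tuplew y : \sum_S tuplew y S = 1.
Proof. by rewrite (sum_prod_ffun (fun=> stepw y)) big1 // => j _; rewrite sum_stepw. Qed.

Lemma codegw_ge0 x S : 0 <= codegw x S.
Proof. by apply: sumr_ge0 => y _; rewrite mulr_ge0 ?adj_ge0 ?tuplew_ge0. Qed.

Lemma sum_codegw : \sum_x \sum_S codegw x S = vol.
Proof.
under eq_bigr => x _ do rewrite exchange_big /=.
rewrite exchange_big /=; apply: eq_bigr => y _.
under eq_bigr => x _ do rewrite -mulr_sumr sum_tuplew mulr1.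
exact: sum_adj.
Qed.

Definition inner (x0 : V) (y : {ffun 'I_k -> V}) (u : U) : V := oapp y x0 u.
Definition starw (x0 : V) (y : {ffun 'I_k -> V}) : R := wdeg x0 * \prod_i stepw x0 (y i).
(* [homw x0 y g / vol] is the law of the stationary random walk indexed by the tree, with centre [x0],
   satellites [y] and roots [g]. *)
Definition homw x0 y (g : {ffun U * 'I_r -> V}) : R :=
  starw x0 y * \prod_u tuplew (inner x0 y u) (row_of g u).

Lemma starw_ge0 x0 y : 0 <= starw x0 y.
Proof. by rewrite mulr_ge0 ?ler0n ?prodr_ge0 // => i _; rewrite stepw_ge0. Qed.

Lemma homw_ge0 x0 y g : 0 <= homw x0 y g.
Proof. by rewrite mulr_ge0 ?starw_ge0 ?prodr_ge0 // => i _; rewrite tuplew_ge0. Qed.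

Lemma sum_starw x0 : \sum_y starw x0 y = wdeg x0.
Proof.
by rewrite -mulr_sumr (sum_prod_ffun (fun=> stepw x0)) big1 ?mulr1 // => i _; rewrite sum_stepw.
Qed.

(** The factor [wdeg x0] cancels the normalisation of one step and leaves the symmetric weight
    [adj]. This reversibility is why stars at the centre and at the satellites have the same law. *)
Lemma sum_starw_at x0 i (h : V -> R) : \sum_(y : {ffun 'I_k ->
  V}) h (y i) * starw x0 y = \sum_v h v * adj x0 v.
Proof.
transitivity (wdeg x0 * \sum_v h v * stepw x0 v).
  rewrite -(@sum_prod_ffun_at _ _ _ (fun _ => stepw x0) i h); last first.
    by move=> *; apply: sum_stepw.
  by rewrite mulr_sumr; apply: eq_bigr => y _; rewrite /starw mulrCA.
rewrite mulr_sumr; apply: eq_bigr => v _; rewrite /stepw.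
by have := wdeg_gt0 x0 => ?; field; lra.
Qed.

Lemma sum_homw_at x0 y u (h : T -> R) :
  \sum_g h (row_of g u) * homw x0 y g = starw x0 y * \sum_S h S * tuplew (inner x0 y u) S.
Proof.
rewrite -(@sum_prod_ffun_at _ _ _ (fun v => tuplew (inner x0 y v)) u h); last first.
  by move=> *; apply: sum_tuplew.
rewrite -(sum_rows (fun g : {ffun U -> T} => h (g u) * \prod_j tuplew (inner x0 y j) (g j))).
rewrite mulr_sumr; apply: eq_bigr => g _; rewrite ffunE /homw mulrCA; congr (_ * (_ * _)).
by apply: eq_bigr => v _; rewrite ffunE.
Qed.

Lemma sum_homw x0 y : \sum_g homw x0 y g = starw x0 y.
Proof.
have := sum_homw_at x0 y None (fun => 1).
under eq_bigr do rewrite mul1r; move=> ->.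
under eq_bigr do rewrite mul1r; by rewrite sum_tuplew mulr1.
Qed.

(** Collisions are rare because a step hits any given vertex with probability at most [1 / d]. *)
Lemma sum_homw_inner x0 :
  \sum_(y : {ffun 'I_k -> V} | ~~ injectiveb y) \sum_g homw x0 y g <= (k ^ 2)%:R / d%:R * wdeg x0.
Proof.
under eq_bigr => y _ do rewrite sum_homw.
rewrite -mulr_sumr mulrC ler_wpM2r ?ler0n //.
have := @sum_noninjective R 'I_k V (fun=> stepw x0) d%:R^-1 1
  (fun _ => stepw_ge0 x0) (fun _ => stepw_le x0) _ _.
rewrite card_ord mulr1; apply; last by rewrite invr_ge0 ler0n.
by move=> i; rewrite big1 // => i' _; rewrite sum_stepw.
Qed.

Lemma sum_homw_roots x0 y :
  \sum_(g : {ffun U * 'I_r -> V} | ~~ injectiveb g) homw x0 y g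
    <= ((k.+1 * r) ^ 2)%:R / d%:R * starw x0 y.
Proof.
rewrite -mulr_sumr mulrC ler_wpM2r ?starw_ge0 //.
have := @sum_noninjective R (U * 'I_r)%type V (fun a => stepw (inner x0 y a.1)) d%:R^-1 1
  (fun _ => stepw_ge0 _) (fun _ => stepw_le _) _ _.
rewrite card_prod card_option !card_ord mulr1 => H; apply: le_trans (H _ _); last first.
- by rewrite invr_ge0 ler0n.
- by move=> i; rewrite big1 // => i' _; rewrite sum_stepw.
apply: ler_sum => g _; rewrite /tuplew pair_big /= le_eqVlt; apply/orP; left; apply/eqP.
by apply: eq_bigr => -[u j] _; rewrite ffunE.
Qed.

(** * Total weight of the light copies *)

Section Light.
Variable hv : V -> T -> bool.

(** The leaves of the star centred at satellite [y i] are [x0] and the roots of that satellite; the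
    star centred at [x0] is tested on [y i] and the roots of the centre. Both conditions thus
    concern stars with [r + 1] leaves. *)
Definition light x0 (y : {ffun 'I_k -> V}) (g : {ffun U * 'I_r -> V}) : bool :=
  [&& injectiveb y, injectiveb g,
      [forall i, ~~ hv x0 (row_of g (Some i))] & [forall i, ~~ hv (y i) (row_of g None)]].

Definition heavy_vol : R := \sum_x \sum_S (hv x S)%:R * codegw x S.

(** Union bound over the ways of failing to be light: coinciding satellites, coinciding roots, and
    [2 * k] stars, each of which contributes exactly [heavy_vol]. *)
Lemma light_total :
  (1 - ((k ^ 2)%:R + ((k.+1 * r) ^ 2)%:R) / d%:R) * vol - (2 * k)%:R * heavy_vol
   <= \sum_x0 \sum_y \sum_(g | light x0 y g) homw x0 y g.
Proof.
pose B1 := \sum_x0 \sum_(y : {ffun 'I_k -> V} | ~~ injectiveb y) \sum_g homw x0 y g.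
pose B2 := \sum_x0 \sum_y \sum_(g : {ffun U * 'I_r -> V} | ~~ injectiveb g) homw x0 y g.
pose B3 (i : 'I_k) := \sum_x0 \sum_(y : {ffun 'I_k ->
  V}) \sum_g (hv x0 (row_of g (Some i)))%:R * homw x0 y g.
pose B4 (i : 'I_k) := \sum_x0 \sum_(y : {ffun 'I_k ->
  V}) \sum_g (hv (y i) (row_of g None))%:R * homw x0 y g.
have B1le : B1 <= (k ^ 2)%:R / d%:R * vol.
  by rewrite mulr_sumr; apply: ler_sum => x0 _; apply: sum_homw_inner.
have B2le : B2 <= ((k.+1 * r) ^ 2)%:R / d%:R * vol.
  rewrite mulr_sumr; apply: ler_sum => x0 _; rewrite -sum_starw mulr_sumr.
  by apply: ler_sum => y _; apply: sum_homw_roots.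
have B3E i : B3 i = heavy_vol.
  apply: eq_bigr => x0 _.
  under eq_bigr => y _.
    rewrite (sum_homw_at x0 y (Some i) (fun S => (hv x0 S)%:R)) /= mulrC; over.
  rewrite (sum_starw_at x0 i (fun v => \sum_S (hv x0 S)%:R * tuplew v S)).
  under eq_bigr => v _ do rewrite mulr_suml.
  rewrite exchange_big /=; apply: eq_bigr => S _; rewrite mulr_sumr.
  by apply: eq_bigr => v _; rewrite adjC; ring.
(* The roles of [x0] and the satellite are exchanged here: the star's centre [x0] is summed out and
   the satellite [v] becomes a leaf. *)
have B4E i : B4 i = heavy_vol.
  rewrite /B4 /heavy_vol.
  under eq_bigr => x0 _.
    under eq_bigr => y _.
      rewrite (sum_homw_at x0 y None (fun S => (hv (y i) S)%:R)) /= mulrC; over.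
    rewrite (sum_starw_at x0 i (fun v => \sum_S (hv v S)%:R * tuplew x0 S)); over.
  rewrite exchange_big /=; apply: eq_bigr => v _.
  under eq_bigr => x0 _ do rewrite mulr_suml.
  rewrite exchange_big /=; apply: eq_bigr => S _; rewrite mulr_sumr.
  by apply: eq_bigr => x0 _; ring.
have tot : \sum_x0 \sum_y \sum_g homw x0 y g = vol.
  apply: eq_bigr => x0 _; under eq_bigr => y _ do rewrite sum_homw; exact: sum_starw.
have : \sum_x0 \sum_y \sum_g homw x0 y g <=
   \sum_x0 \sum_y \sum_(g | light x0 y g) homw x0 y g + (B1 + B2 + \sum_i (B3 i + B4 i)).
  have -> : \sum_i (B3 i + B4 i) = \sum_x0 \sum_y \sum_g
     (\sum_i ((hv x0 (row_of g (Some i)))%:R * homw x0 y g + (hv (y i) (row_of g None))%:R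
       * homw x0 y g)).
    under eq_bigr => i _ do rewrite /B3 /B4 -big_split /=.
    rewrite exchange_big; apply: eq_bigr => x0 _ /=.
    under eq_bigr => i _ do rewrite -big_split /=.
    rewrite exchange_big; apply: eq_bigr => y _ /=.
    under eq_bigr => i _ do rewrite -big_split /=.
    by rewrite exchange_big.
  rewrite -!big_split /=; apply: ler_sum => x0 _.
  rewrite [X in _ <= _ + (X + _ + _)]big_mkcond -!big_split /=; apply: ler_sum => y _.
  have -> : (if ~~ injectiveb y then \sum_g homw x0 y g else 0) =
     \sum_g (~~ injectiveb y)%:R * homw x0 y g.
     by rewrite -mulr_sumr; case: (injectiveb y); rewrite ?mul0r ?mul1r.
  rewrite !(big_mkcond (fun g => light x0 y g)) !(big_mkcond (fun g => ~~ _)) -!big_split /=.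
  apply: ler_sum => g _; have h0 := homw_ge0 x0 y g.
  have s0 P Q : 0 <= \sum_(i : 'I_k | P i)
    ((hv x0 (row_of g (Some i)))%:R * homw x0 y g + (Q i : bool)%:R * homw x0 y g).
    by apply: sumr_ge0 => i _; rewrite addr_ge0 // mulr_ge0 ?ler0n.
  have s1 := s0 xpredT (fun i => hv (y i) (row_of g None)); rewrite /= in s1.
  have m0 (b : bool) : 0 <= b%:R * homw x0 y g by rewrite mulr_ge0 ?ler0n.
  case: ifP => [_|]; first by case: (injectiveb y); case: ifP; rewrite ?mul0r ?mul1r; lra.
  rewrite /light; case: (injectiveb y) => /=; last by case: ifP; rewrite ?mul1r; lra.
  case: (injectiveb g) => /=; last by rewrite mul0r; lra.
  move/negbT; rewrite negb_and !negb_forall => /orP[] /existsP[i]; rewrite negbK => hi.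
    rewrite (bigD1 i) //= hi.
  have := s0 (fun i' => i' != i) (fun i => hv (y i) (row_of g None)).
  set z := \sum_(_ | _) _ => z0.
  have := m0 (hv (y i) (row_of g None)); rewrite !mul1r !mul0r; lra.
  rewrite (bigD1 i) //= hi.
  have := s0 (fun i' => i' != i) (fun i => hv (y i) (row_of g None)).
  set z := \sum_(_ | _) _ => z0.
  have := m0 (hv x0 (row_of g (Some i))); rewrite !mul1r !mul0r; lra.
rewrite tot; have -> : \sum_i (B3 i + B4 i) = \sum_(i : 'I_k) (heavy_vol + heavy_vol).
  by apply: eq_bigr => i _; rewrite B3E B4E.
rewrite sumr_const card_ord -mulr_natl natrM => H.
apply: le_trans (_ : vol - (B1 + B2 + k%:R * (heavy_vol + heavy_vol)) <= _); last lra.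
lra.
Qed.
End Light.

(** Since [tuplew] never exceeds [d ^- r], codegree [tau] forces at least [L] genuine common
    neighbours, see [heavy_card]. *)
Definition tau : R := L%:R / d%:R ^+ r.
Definition heavy (x : V) (S : T) : bool := tau <= codegw x S.

Let dR : 0 < d%:R :> R. Proof. by rewrite ltr0n. Qed.

Lemma tau_ge0 : 0 <= tau. Proof. by rewrite divr_ge0 ?exprn_ge0 ?ler0n. Qed.

Lemma tuplew_le y S : tuplew y S <= (d%:R ^+ r)^-1.
Proof.
rewrite -exprVn -[r in leRHS]card_ord -prodr_const; apply: ler_prod => j _.
by rewrite stepw_ge0 stepw_le.
Qed.

(** Bound for the light weight through one vertex when the roots are fixed: [d ^- r] comes from one
    row of roots, [tau] from a codegree with no degree left to divide by, and [tau / d] from each of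
    the [k - 1] remaining satellites. *)
Definition vertex_cap : R := (d%:R ^+ r)^-1 * tau * (tau / d%:R) ^+ k.-1.

Lemma vertex_cap_ge0 : 0 <= vertex_cap.
Proof.
by rewrite /vertex_cap !mulr_ge0 ?exprn_ge0 ?divr_ge0 ?invr_ge0 ?exprn_ge0 ?tau_ge0 ?ler0n.
Qed.

(** * Light copies on fixed roots *)

Section Roots.
Variable g : {ffun U * 'I_r -> V}.
Notation hom := (fun m : V * {ffun 'I_k -> V} => homw m.1 m.2 g).
Notation lig := (fun m : V * {ffun 'I_k -> V} => light heavy m.1 m.2 g).

Lemma homw_factor x0 y : homw x0 y g = wdeg x0 * tuplew x0 (row_of g None) *
   \prod_i (stepw x0 (y i) * tuplew (y i) (row_of g (Some i))).
Proof.
rewrite /homw /starw (bigD1 None) //= [in RHS]big_split /=.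
have -> : \prod_(u | u != None) tuplew (inner x0 y u) (row_of g u) =
   \prod_i tuplew (y i) (row_of g (Some i)).
  rewrite (reindex_omap Some id) //=; last by case.
  by apply: eq_big => [i|i _]; rewrite ?eqxx.
exact: mulrACA.
Qed.

Lemma sum_stepw_tuplew x0 S : \sum_z stepw x0 z * tuplew z S = codegw x0 S / wdeg x0.
Proof.
rewrite /codegw mulr_suml; apply: eq_bigr => z _; rewrite /stepw (adjC x0); ring.
Qed.

Let rootlight x0 := [forall i, ~~ heavy x0 (row_of g (Some i))].

Lemma codegw_wdeg_le x0 i : rootlight x0 ->
  codegw x0 (row_of g (Some i)) / wdeg x0 <= tau / wdeg x0.
Proof.
move=> /forallP/(_ i); rewrite -ltNge => h.
by rewrite ler_wpM2r ?invr_ge0 ?ler0n // ltW.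
Qed.

Lemma tau_wdeg_le x0 : tau / wdeg x0 <= tau / d%:R.
Proof.
by rewrite ler_wpM2l ?tau_ge0 // lef_pV2 ?posrE ?wdeg_gt0 ?wdeg_ge.
Qed.

Lemma codegw_wdeg_ge0 x0 S : 0 <= codegw x0 S / wdeg x0.
Proof. by rewrite divr_ge0 ?codegw_ge0 ?ler0n. Qed.

(** With the centre [v] fixed, the satellites sum independently, each to a codegree over [wdeg v].
    Lightness bounds these codegrees by [tau], and the factor [wdeg v] of the star cancels one of
    the denominators. *)
Lemma center_weight v : \sum_(m | lig m && (m.1 == v)) hom m <= vertex_cap.
Proof.
have cap0 := vertex_cap_ge0.
have [lv|nl] := boolP (rootlight v); last first.
  rewrite big1 // => m /andP[/and4P[_ _ h _] /eqP mv]; move: nl; rewrite /rootlight -mv.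
  by rewrite h.
apply: (@le_trans _ _ (\sum_(y : {ffun 'I_k -> V}) homw v y g)).
  rewrite -(pair_big_dep xpredT (fun x y => light heavy x y g && (x == v)) (fun x y =>
    homw x y g)) /=.
  rewrite (bigD1 v) //= [X in _ + X]big1 ?addr0; last first.
    by move=> x /negPf xv; rewrite big_pred0 // => y; rewrite xv andbF.
  rewrite [leRHS](bigID (fun y => light heavy v y g && (v == v))) /= lerDl.
  by apply: sumr_ge0 => y _; apply: homw_ge0.
under eq_bigr => y _ do rewrite homw_factor.
rewrite -mulr_sumr (sum_prod_ffun (fun i z => stepw v z * tuplew z (row_of g (Some i)))).
rewrite (bigD1 (Ordinal k_gt0)) //= sum_stepw_tuplew.
have dv := wdeg_gt0 v.
have -> (a b c : R) : wdeg v * a * (b / wdeg v * c) = a * b * c by field; lra.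
have lv0 : codegw v (row_of g (Some (Ordinal k_gt0))) <= tau.
  by have /forallP/(_ (Ordinal k_gt0)) := lv; rewrite -ltNge => /ltW.
rewrite /vertex_cap; apply: ler_pM.
- by rewrite mulr_ge0 ?tuplew_ge0 ?codegw_ge0.
- by apply: prodr_ge0 => i _; rewrite sum_stepw_tuplew codegw_wdeg_ge0.
- by apply: ler_pM; rewrite ?tuplew_ge0 ?codegw_ge0 ?tuplew_le.
have -> : (tau / d%:R) ^+ k.-1 = \prod_(i < k | i != Ordinal k_gt0) (tau / d%:R).
  rewrite prodr_const; congr (_ ^+ _).
  by have := cardC1 (Ordinal k_gt0); rewrite card_ord => <-; apply: eq_card => i; rewrite !inE.
apply: ler_prod => i _; rewrite sum_stepw_tuplew codegw_wdeg_ge0 /=.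
exact: le_trans (codegw_wdeg_le i lv) (tau_wdeg_le v).
Qed.

(** With satellite [i] fixed at [v], the other satellites sum to at most [tau / d] each. The
    remaining sum over the centre is the codegree of [v] and the centre's roots, at most [tau]
    because the star at the centre is light. *)
Lemma satellite_weight v i : \sum_(m | lig m && (m.2 i == v)) hom m <= vertex_cap.
Proof.
have cap0 := vertex_cap_ge0.
have [lv|nl] := boolP (heavy v (row_of g None)).
  rewrite big1 // => m /andP[/and4P[_ _ _ /forallP/(_ i) h] /eqP mv].
  by move: h; rewrite mv lv.
apply: (@le_trans _ _ (\sum_(x | rootlight x) \sum_(y : {ffun 'I_k -> V} | y i == v) homw x y g)).
  rewrite -(pair_big_dep xpredT (fun x y => light heavy x y g && (y i == v)) (fun x y =>
    homw x y g)) /=.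
  rewrite [leRHS]big_mkcond; apply: ler_sum => x _; case: ifP => [_|nx]; last first.
    by rewrite big_pred0 // => y; rewrite /light -/(rootlight x) nx /= !andbF.
  rewrite [leLHS]big_mkcond [leRHS]big_mkcond; apply: ler_sum => y _.
  have := homw_ge0 x y g.
  by case: (light _ _ _ _); case: (y i == v).
apply: (@le_trans _ _ (\sum_x (d%:R ^+ r)^-1 * (tau / d%:R) ^+ k.-1 * (adj x v
  * tuplew x (row_of g None)))).
  rewrite [leLHS]big_mkcond; apply: ler_sum => x _.
  have P0 : 0 <= (d%:R ^+ r)^-1 * (tau / d%:R) ^+ k.-1.
    by rewrite !mulr_ge0 ?exprn_ge0 ?divr_ge0 ?invr_ge0 ?exprn_ge0 ?tau_ge0 ?ler0n.
  case: ifP => [lx|_]; last by rewrite mulr_ge0 // mulr_ge0 ?tuplew_ge0 ?adj_ge0.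
  under eq_bigr => y _ do rewrite homw_factor.
  rewrite -mulr_sumr (sum_prod_ffun_eq (fun i z => stepw x z * tuplew z (row_of g (Some i)))).
  have dx := wdeg_gt0 x.
  rewrite /stepw -/(stepw _ _).
  have -> (a b c p : R) : wdeg x * a * (b / wdeg x * p * c) = (b * a) * (p * c) by field; lra.
  rewrite [leRHS]mulrC; apply: ler_wpM2l; first by rewrite mulr_ge0 ?tuplew_ge0 ?adj_ge0.
  apply: ler_pM; rewrite ?tuplew_ge0 ?tuplew_le //.
    by apply: prodr_ge0 => j _; rewrite sum_stepw_tuplew codegw_wdeg_ge0.
  have -> : (tau / d%:R) ^+ k.-1 = \prod_(j < k | j != i) (tau / d%:R).
    rewrite prodr_const; congr (_ ^+ _).
    by have := cardC1 i; rewrite card_ord => <-; apply: eq_card => j; rewrite !inE.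
  apply: ler_prod => j _; rewrite sum_stepw_tuplew codegw_wdeg_ge0 /=.
  exact: le_trans (codegw_wdeg_le j lx) (tau_wdeg_le x).
rewrite -mulr_sumr -/(codegw v (row_of g None)) /vertex_cap mulrAC.
apply: ler_wpM2r; first by apply: exprn_ge0; apply: divr_ge0; rewrite ?tau_ge0 ?ler0n.
apply: ler_wpM2l; first by rewrite invr_ge0 exprn_ge0 ?ler0n.
by rewrite ltW // ltNge.
Qed.

Lemma light_embedding_at : injective g ->
  (k.+1 * r + l * k.+1)%:R * (k.+1%:R * vertex_cap) < \sum_(m | lig m) hom m ->
  blowup_embedding e k r l.
Proof.
move=> g_inj tot.
(* Copies of weight zero are discarded, since a nonzero weight is what certifies that all tree edges
   are present. *)
pose P m := lig m && (hom m != 0).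
have cap0 := vertex_cap_ge0.
have sumP Q : \sum_(m | P m && Q m) hom m = \sum_(m | lig m && Q m) hom m.
  rewrite [LHS]big_mkcond [RHS]big_mkcond; apply: eq_bigr => m _; rewrite /P.
  by case: lig; case: (Q m) => //=; rewrite ?andbT; case: eqP => // ->.
pose occ (m : V * {ffun 'I_k -> V}) := [set inner m.1 m.2 u | u : U].
have [|||||x [xP xZ xx]] := @greedy_disjoint R V _ P hom occ (k.+1%:R
  * vertex_cap) (g @: [set: U * 'I_r]) l k.+1 _ _ _ _ _.
- by rewrite mulr_ge0 ?ler0n.
- by move=> m; apply: homw_ge0.
- by move=> m; apply: leq_trans (leq_imset_card _ _) _; rewrite card_option card_ord.
- move=> v; apply: (@le_trans _ _ (\sum_(u : U) \sum_(m | P m && (inner m.1 m.2 u == v)) hom m)).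
    rewrite (exchange_big_dep P) /=; last by move=> u m _ /andP[].
    rewrite [leRHS]big_mkcond [leLHS]big_mkcond; apply: ler_sum => m _.
    case: (P m) => //=; case: imsetP => [[u _ ->]|_]; last first.
      by apply: sumr_ge0 => u _; apply: homw_ge0.
    rewrite (bigD1 u) //= lerDl; apply: sumr_ge0 => u' _; exact: homw_ge0.
  have -> : k.+1%:R * vertex_cap = \sum_(u : U) vertex_cap.
    by rewrite sumr_const card_option card_ord -[RHS]mulr_natl.
  apply: ler_sum => -[i|] _ /=; rewrite sumP; first exact: satellite_weight.
  exact: center_weight.
- have -> : \sum_(m | P m) hom m = \sum_(m | lig m) hom m.
    by have := sumP xpredT; under eq_bigl do rewrite andbT; under [RHS]eq_bigl do rewrite andbT.
  apply: le_lt_trans tot; apply: ler_wpM2r; first by rewrite mulr_ge0 ?ler0n.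
  rewrite ler_nat leq_add2r; apply: leq_trans (leq_imset_card _ _) _.
  by rewrite cardsT card_prod card_option !card_ord.
have occI j u : inner (x j).1 (x j).2 u \in occ (x j) by apply: imset_f.
have edges j : (forall i, e (x j).1 ((x j).2 i)) /\ forall u i,
  e (inner (x j).1 (x j).2 u) (g (u, i)).
  have /andP[_] := xP j; rewrite /homw /starw !mulf_eq0 !negb_or -andbA => /and3P[_ h1 h2].
  have stepwE a b : stepw a b != 0 -> e a b.
    by rewrite /stepw /adj; case: (e a b) => //; rewrite mul0r eqxx.
  split=> [i|u i].
    by apply: stepwE; move/prodf_neq0: h1; apply.
  move/prodf_neq0: h2 => /(_ u isT); rewrite /tuplew => /prodf_neq0/(_ i isT).
  by rewrite ffunE => /stepwE.
exists g, (fun j => inner (x j).1 (x j).2); split=> //.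
- move=> j u j' u' E; have jj : j = j'.
    apply/eqP/negPn/negP => /xx; rewrite disjoint_subset => /subsetP/(_ _ (occI j u)).
    by rewrite inE E occI.
  split=> //; move: E; rewrite -jj {jj}.
  have /andP[/and4P[/injectiveP yi _ _ _] _] := xP j.
  have [xy _] := edges j.
  case: u => [i|]; case: u' => [i'|] //= E.
  - by rewrite (yi _ _ E).
  - by have := xy i; rewrite E e_irr.
  - by have := xy i'; rewrite -E e_irr.
- move=> j u a E; have := xZ j; rewrite disjoint_subset => /subsetP/(_ _ (occI j u)).
  by rewrite inE E imset_f.
- by move=> j u i; have [_ ->] := edges j.
- by move=> j i; have [-> _] := edges j.
Qed.
End Roots.

(** Averaging over the root tuples: at least half of [vol] is light, so some injective tuple [g]
    carries enough weight for the greedy choice of [light_embedding_at]. *)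
Lemma light_embedding :
  (8 * k)%:R * heavy_vol heavy <= vol ->
  (4 * (k ^ 2 + (k.+1 * r) ^ 2) <= d)%N ->
  (2 * ((k.+1 * r + l * k.+1) * (k.+1 * L ^ k)) * #|V| ^ (k.+1 * r)
     < #|V| * d ^ (k.+1 * r + k))%N ->
  blowup_embedding e k r l.
Proof.
move=> hvol d_big dn.
have vol_ge : (#|V| * d)%:R <= vol.
  rewrite /vol natrM mulr_natl -sumr_const; apply: ler_sum => x _; exact: wdeg_ge.
have tot := light_total heavy.
have {tot}tot : vol / 2 <= \sum_x0 \sum_(y : {ffun 'I_k ->
  V}) \sum_(g | light heavy x0 y g) homw x0 y g.
  apply: le_trans tot.
  have : ((k ^ 2)%:R + ((k.+1 * r) ^ 2)%:R) / d%:R <= 4^-1 :> R.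
    rewrite ler_pdivrMr // -natrD.
    by move: d_big; rewrite -(ler_nat R) natrM; lra.
  have v0 : 0 <= vol by apply: sumr_ge0 => x _; apply: ler0n.
  move: hvol; rewrite !natrM; set a := _ / _; set h := heavy_vol _; set v := vol => hvol ha.
  have : a * v <= 4^-1 * v by rewrite ler_wpM2r.
  lra.
pose B := (k.+1 * r + l * k.+1)%:R * (k.+1%:R * vertex_cap).
have [/existsP[g /andP[/injectiveP gi gB]]|] := boolP [exists g : {ffun U * 'I_r -> V},
    injectiveb g && (B < \sum_(m | light heavy m.1 m.2 g) homw m.1 m.2 g)].
  exact: light_embedding_at gi gB.
rewrite negb_exists => /forallP noG.
suff : vol / 2 <= (#|V| ^ (k.+1 * r))%:R * B.
  suff : (#|V| ^ (k.+1 * r))%:R * B < (#|V| * d)%:R / 2 by lra.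
  rewrite /B /vertex_cap /tau.
  have dR' (a : nat) : 0 < d%:R ^+ a :> R by rewrite exprn_gt0.
  have -> : (d%:R ^+ r)^-1 * (L%:R / d%:R ^+ r) * (L%:R / d%:R ^+ r / d%:R) ^+ k.-1
     = L%:R ^+ k * d%:R / d%:R ^+ (k.+1 * r + k) :> R.
    rewrite -[in RHS](prednK k_gt0) exprD [(_ * r)%N]mulnC exprM !exprS !exprMn !exprVn.
    have := dR' r; have := dR' k.-1; have := exprn_gt0 k.-1 (dR' r).
    set a := (d%:R ^+ r) ^+ _; set b := d%:R ^+ k.-1; set c := d%:R ^+ r => a0 b0 c0.
    by field; rewrite !gt_eqF.
  move: dn; rewrite -(ltr_nat R) !natrM !natrX => dn.
  set D := d%:R ^+ (k.+1 * r + k) in dn *; have D0 : 0 < D by apply: dR'.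
  have -> : #|V|%:R * d%:R / 2 = d%:R * (#|V|%:R * D) / (2 * D) by field; rewrite gt_eqF.
  rewrite ltr_pdivlMr ?mulr_gt0 //.
  set M := _ ^+ (_ * _); set Lk := L%:R ^+ k.
  have -> (a b : R) : M * (a * (b * (Lk * d%:R / D))) * (2 * D) = d%:R * (2 * (a * (b * Lk)) * M).
    by field; rewrite gt_eqF.
  by rewrite ltr_pM2l.
apply: le_trans tot _.
have -> : \sum_x0 \sum_(y : {ffun 'I_k -> V}) \sum_(g | light heavy x0 y g) homw x0 y g =
    \sum_(g : {ffun U * 'I_r -> V}) \sum_(m | light heavy m.1 m.2 g) homw m.1 m.2 g.
  rewrite pair_big /= (exchange_big_dep xpredT) //=.
have B0 : 0 <= B.
  by apply: mulr_ge0; rewrite ?ler0n //; apply: mulr_ge0; rewrite ?ler0n ?vertex_cap_ge0.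
have -> : (#|V| ^ (k.+1 * r))%:R * B = \sum_(g : {ffun U * 'I_r -> V}) B.
  rewrite sumr_const card_ffun card_prod card_option !card_ord.
  by rewrite -[RHS]mulr_natl.
apply: ler_sum => g _; have := noG g; rewrite negb_and -leNgt => /orP[ng|//].
by rewrite big_pred0 // => m; rewrite /light (negPf ng) andbF.
Qed.

(** * Heavy stars and dense common neighbourhoods *)

Let dr_gt0 : 0 < d%:R ^+ r :> R. Proof. by rewrite exprn_gt0. Qed.

Let expr_r (x : R) : x ^+ r = x * x ^+ r.-1.
Proof. by rewrite -exprS prednK. Qed.

Definition common (S : T) : {set V} := [set v | [forall j, e (S j) v]].
Definition inside (S0 S : T) : bool := [forall j, S j \in common S0].
(** The degree factors left when each [S0 j] takes its [r] steps to the entries of [S]; they are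
    independent of [x] and [S]. *)
Definition rootw (S0 : T) : R := \prod_j (wdeg (S0 j) ^+ r)^-1.

Definition cow (y x : V) (S : T) : R := adj y x * tuplew y S.

Lemma cow_ge0 y x S : 0 <= cow y x S.
Proof. by rewrite mulr_ge0 ?adj_ge0 ?tuplew_ge0. Qed.

Lemma cow_le y x S : cow y x S <= (d%:R ^+ r)^-1.
Proof.
rewrite /cow /adj; case: (e y x); rewrite ?mul1r ?mul0r ?tuplew_le //.
by rewrite invr_ge0 ltW.
Qed.

Lemma rootw_ge0 S0 : 0 <= rootw S0.
Proof. by apply: prodr_ge0 => j _; rewrite invr_ge0 exprn_ge0 ?ler0n. Qed.

Lemma rootw_le S0 : rootw S0 <= ((d%:R ^+ r)^-1) ^+ r.
Proof.
have -> : (d%:R ^+ r)^-1 ^+ r = \prod_(j < r) (d%:R ^+ r)^-1 :> R.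
  by rewrite prodr_const card_ord.
apply: ler_prod => j _; have h := wdeg_gt0 (S0 j); rewrite invr_ge0 exprn_ge0 ?(ltW h) //=.
rewrite lef_pV2 ?posrE ?exprn_gt0 //.
by apply: lerXn2r; rewrite ?nnegrE ?ler0n ?wdeg_ge.
Qed.

Lemma prod_cow (S0 : T) x S : \prod_j cow (S0 j) x S
  = rootw S0 * ((x \in common S0) && inside S0 S)%:R.
Proof.
have tuplewE y : tuplew y S = (wdeg y ^+ r)^-1 * [forall j, e y (S j)]%:R.
  rewrite /tuplew /stepw big_split /= prod_natb mulrC prodr_const card_ord.
  by rewrite exprVn.
rewrite /cow (eq_bigr (fun j => (wdeg (S0 j) ^+ r)^-1 * (e (S0 j) x && [forall i,
  e (S0 j) (S i)])%:R)).
  rewrite big_split /= prod_natb /rootw; congr (_ * _%:R); congr nat_of_bool.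
  apply/forallP/andP => [h|[h1 h2] j].
    split; first by rewrite inE; apply/forallP => j; have /andP[] := h j.
    apply/forallP => i; rewrite inE; apply/forallP => j; have /andP[_ /forallP] := h j; exact.
  move: h1; rewrite inE => /forallP -> /=; apply/forallP => i.
  by have /forallP/(_ i) := h2; rewrite inE => /forallP.
by move=> j _; rewrite tuplewE /adj -mulnb natrM mulrCA.
Qed.

Lemma codegw_exp x S : codegw x S ^+ r = \sum_(S0 : T) \prod_j cow (S0 j) x S.
Proof.
by rewrite (sum_prod_ffun (fun _ y => cow y x S)) prodr_const card_ord.
Qed.

(** Tuples [S0] with a repetition contribute at most [r ^ 2 * d ^- r * codegw ^+ r.-1]. As [codegw]
    is at least [L * d ^- r] and [L] at least [2 * r ^ 2], this is at most half of [codegw ^+ r]. *)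
Lemma heavy_injective x S : (2 * r ^ 2 <= L)%N -> heavy x S ->
  codegw x S ^+ r <= 2 * \sum_(S0 : T | injectiveb S0) \prod_j cow (S0 j) x S.
Proof.
move=> rL hv; rewrite codegw_exp [X in X <= _](bigID (fun S0 : T => injectiveb S0)) /=.
set a := \sum_(_ | _) _; set b := \sum_(_ | ~~ _) _.
suff : b <= codegw x S ^+ r / 2.
  by rewrite codegw_exp [X in X / 2](bigID (fun S0 : T => injectiveb S0)) /= -/a -/b; lra.
have := @sum_noninjective R 'I_r V (fun _ y =>
  cow y x S) (d%:R ^+ r)^-1 (codegw x S ^+ r.-1) _ _ _ _.
rewrite card_ord => H; apply: le_trans (H _ _ _ _) _ => {H}.
- by move=> _ v; apply: cow_ge0.
- by move=> _ v; apply: cow_le.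
- move=> j; rewrite prodr_const; set c := #|_|.
  have -> : c = r.-1.
    by have := cardC1 j; rewrite card_ord => <-; apply: eq_card => i; rewrite !inE.
  exact: lexx.
- by rewrite invr_ge0 ltW.
rewrite [codegw x S ^+ r]expr_r mulrA [X in _ <= X]mulrAC.
apply: ler_wpM2r; first by rewrite exprn_ge0 ?codegw_ge0.
apply: le_trans (_ : tau / 2 <= _); last by rewrite ler_wpM2r ?invr_ge0 ?ler0n.
rewrite /tau mulrAC ler_wpM2r ?invr_ge0 ?(ltW dr_gt0) //.
by move: rL; rewrite -(ler_nat R) natrM; lra.
Qed.

(* Both masses count complete bipartite graphs between an [r]-tuple [S0], weighted by [rootw], and
   [r + 1] further vertices; summing over the latter first gives powers of the codegrees. *)
Definition heavy_mass : R := \sum_(S0 : T | injectiveb S0) rootw S0 *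
  \sum_(x in common S0) \sum_(S | inside S0 S) (heavy x S)%:R.
Definition total_mass : R := \sum_(S0 : T) rootw S0 * #|common S0|%:R ^+ r.+1.

Lemma card_inside (S0 : T) : #|[set S | inside S0 S]| = (#|common S0| ^ r)%N.
Proof.
rewrite -[r in RHS]card_ord -card_ffun_on; apply: eq_card => S; rewrite !inE.
by apply/forallP/ffun_onP.
Qed.

Lemma sum_inside (S0 : T) (F : V -> T -> R) :
  \sum_x \sum_S ((x \in common S0) && inside S0 S)%:R * F x S =
  \sum_(x in common S0) \sum_(S | inside S0 S) F x S.
Proof.
rewrite [RHS]big_mkcond; apply: eq_bigr => x _; case: ifP => _ /=; last first.
  by rewrite big1 // => S _; rewrite mul0r.
by rewrite [RHS]big_mkcond; apply: eq_bigr => S _; case: ifP; rewrite ?mul1r ?mul0r.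
Qed.

Lemma heavy_massE : heavy_mass
  = \sum_x \sum_S (heavy x S)%:R * \sum_(S0 : T | injectiveb S0) \prod_j cow (S0 j) x S.
Proof.
under [RHS]eq_bigr => x _.
  under eq_bigr => S _ do rewrite mulr_sumr.
  rewrite exchange_big /=; over.
rewrite exchange_big /=; apply: eq_bigr => S0 _; rewrite -sum_inside mulr_sumr.
apply: eq_bigr => x _; rewrite mulr_sumr; apply: eq_bigr => S _; rewrite prod_cow; ring.
Qed.

Lemma total_massE : total_mass = \sum_x \sum_S codegw x S ^+ r.
Proof.
under [RHS]eq_bigr => x _.
  under eq_bigr => S _ do rewrite codegw_exp.
  rewrite exchange_big /=; over.
rewrite exchange_big /=; apply: eq_bigr => S0 _.
have -> : #|common S0|%:R ^+ r.+1 = \sum_(x in common S0) \sum_(S | inside S0 S) 1 :> R.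
  under eq_bigr => x _ do rewrite sumr_const -cardsE card_inside.
  by rewrite sumr_const -mulrnA exprS -natrX -natrM mulnC.
rewrite -sum_inside mulr_sumr.
by apply: eq_bigr => x _; rewrite mulr_sumr; apply: eq_bigr => S _; rewrite prod_cow mulr1.
Qed.

Section Dominated.
Hypothesis L_big : (2 * r ^ 2 <= L)%N.
Hypothesis heavy_big : vol < (8 * k)%:R * heavy_vol heavy.

Definition heavy_moment : R := \sum_x \sum_S (heavy x S)%:R * codegw x S ^+ r.

Lemma tau_heavy : tau ^+ r.-1 * heavy_vol heavy <= heavy_moment.
Proof.
rewrite mulr_sumr; apply: ler_sum => x _; rewrite mulr_sumr; apply: ler_sum => S _.
case hv: (heavy x S); rewrite ?mul0r ?mulr0 // !mul1r [codegw x S ^+ r]expr_r.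
rewrite mulrC ler_wpM2l ?codegw_ge0 // lerXn2r ?nnegrE ?tau_ge0 ?codegw_ge0 //.
Qed.

Lemma heavy_moment_le : heavy_moment <= 2 * heavy_mass.
Proof.
rewrite heavy_massE mulr_sumr; apply: ler_sum => x _; rewrite mulr_sumr; apply: ler_sum => S _.
case hv: (heavy x S); rewrite ?mul0r ?mulr0 // !mul1r.
exact: heavy_injective.
Qed.

(** On light pairs the [r]-th power of the codegree is at most [tau ^+ r.-1] times the codegree, so
    they contribute at most [tau ^+ r.-1 * vol]. By [heavy_big] and [tau_heavy] this is within a
    factor [8 * k] of the heavy moment. *)
Lemma total_mass_le : total_mass <= (2 * (8 * k).+1)%:R * heavy_mass.
Proof.
apply: le_trans (_ : heavy_moment + tau ^+ r.-1 * vol <= _).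
  rewrite total_massE -sum_codegw mulr_sumr -big_split /=; apply: ler_sum => x _.
  rewrite mulr_sumr -big_split /=; apply: ler_sum => S _.
  have t0 : 0 <= tau ^+ r.-1 * codegw x S by rewrite mulr_ge0 ?exprn_ge0 ?tau_ge0 ?codegw_ge0.
  case hv: (heavy x S); rewrite ?mul0r ?mul1r ?add0r ?lerDl //.
  rewrite [codegw x S ^+ r]expr_r mulrC ler_wpM2r ?codegw_ge0 // lerXn2r ?nnegrE ?tau_ge0
    ?codegw_ge0 //.
  by move/negbT: hv; rewrite -ltNge => /ltW.
apply: le_trans (_ : (8 * k).+1%:R * heavy_moment <= _); last first.
  by rewrite natrM -[X in _ <= X]mulrA [X in _ <= X]mulrCA; apply: ler_wpM2l;
    rewrite ?ler0n ?heavy_moment_le.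
rewrite -[(8 * k).+1]add1n natrD mulrDl mul1r lerD2l.
apply: le_trans (ler_wpM2l (exprn_ge0 _ tau_ge0) (ltW heavy_big)) _.
by rewrite mulrCA ler_wpM2l ?ler0n ?tau_heavy.
Qed.

Lemma heavy_mass_ge : (#|V| * d)%:R * tau ^+ r.-1 <= (16 * k)%:R * heavy_mass.
Proof.
have vol_ge : (#|V| * d)%:R <= vol.
  rewrite /vol natrM mulr_natl -sumr_const; apply: ler_sum => x _; exact: wdeg_ge.
have t0 : 0 <= tau ^+ r.-1 by rewrite exprn_ge0 ?tau_ge0.
apply: le_trans (ler_wpM2r t0 vol_ge) _.
apply: le_trans (ler_wpM2r t0 (ltW heavy_big)) _.
rewrite -mulrA [heavy_vol _ * _]mulrC.
have -> : (16 * k)%:R * heavy_mass = (8 * k)%:R * (2 * heavy_mass).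
  by rewrite !natrM; ring.
by apply: ler_wpM2l; rewrite ?ler0n // (le_trans tau_heavy heavy_moment_le).
Qed.

(** Otherwise each injective [S0] either has a small common neighbourhood or a low heavy density.
    The latter tuples hold at most half of [heavy_mass] by [total_mass_le], so the former hold the
    rest, which is less than [heavy_mass_ge] demands. *)
Lemma dense_common (n0 : nat) :
  (32 * k * n0 ^ r.+1 * #|V| ^ r < #|V| * d ^ r.+1)%N ->
  exists S0 : T, [/\ injective S0, (n0 <= #|common S0|)%N &
    #|common S0|%:R ^+ r.+1 <= (4 * (8 * k).+1)%:R *
      \sum_(x in common S0) \sum_(S | inside S0 S) (heavy x S)%:R :> R].
Proof.
move=> nd.
have [/existsP[S0 /and3P[/injectiveP h1 h2 h3]]|] := boolP [exists S0 : T,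
  [&& injectiveb S0, (n0 <= #|common S0|)%N &
    #|common S0|%:R ^+ r.+1 <= (4 * (8 * k).+1)%:R *
      \sum_(x in common S0) \sum_(S | inside S0 S) (heavy x S)%:R :> R]].
  by exists S0.
rewrite negb_exists => /forallP no.
(* Twice the constant of [total_mass_le], so that the sparse tuples account for at most half. *)
pose Q : R := (4 * (8 * k).+1)%:R.
have Q0 : 0 < Q by rewrite ltr0n.
pose small : R := (#|V| ^ r)%:R * (((d%:R ^+ r)^-1) ^+ r * n0%:R ^+ r.+1).
have QmassA : Q * heavy_mass <= Q * small + total_mass.
  have -> : small = \sum_(S0 : T) ((d%:R ^+ r)^-1) ^+ r * n0%:R ^+ r.+1.
    by rewrite sumr_const card_ffun card_ord -[RHS]mulr_natl.
  rewrite !mulr_sumr -big_split /= big_mkcond; apply: ler_sum => S0 _.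
  have s0 : 0 <= Q * (((d%:R ^+ r)^-1) ^+ r * n0%:R ^+ r.+1).
    by rewrite !mulr_ge0 ?exprn_ge0 ?ler0n ?invr_ge0 ?exprn_ge0 // ltW.
  have b0 : 0 <= rootw S0 * #|common S0|%:R ^+ r.+1.
    by rewrite mulr_ge0 ?rootw_ge0 ?exprn_ge0 ?ler0n.
  case: ifP => [inj|_]; last exact: addr_ge0.
  have hle : \sum_(x in common S0) \sum_(S | inside S0 S) (heavy x S)%:R
    <= #|common S0|%:R ^+ r.+1 :> R.
    apply: (@le_trans _ _ (\sum_(x in common S0) \sum_(S | inside S0 S) 1)).
      by apply: ler_sum => x _; apply: ler_sum => S _; case: (heavy x S); rewrite ?ler01.
    under eq_bigr => x _ do rewrite sumr_const -cardsE card_inside.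
    by rewrite sumr_const -mulrnA exprS -natrX -natrM mulnC.
  have := no S0; rewrite inj /= negb_and -ltnNge -ltNge => /orP[sm|/ltW hv].
    apply: ler_wpDr b0 _; apply: ler_wpM2l; first exact: ltW.
    apply: ler_pM (rootw_ge0 _) _ (rootw_le _) _.
      by apply: sumr_ge0 => x _; apply: sumr_ge0 => S _; apply: ler0n.
    apply: le_trans hle _; rewrite lerXn2r ?nnegrE ?ler0n // ler_nat ltnW //.
  by apply: ler_wpDl s0 _; rewrite mulrCA; apply: ler_wpM2l; rewrite ?rootw_ge0.
have totalA := total_mass_le; have Age := heavy_mass_ge.
have : Q * heavy_mass <= 2 * (Q * small).
  have : total_mass <= Q / 2 * heavy_mass.
    by apply: le_trans totalA _; rewrite /Q !natrM; lra.
  lra.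
rewrite mulrCA ler_pM2l // => As.
suff : (32 * k)%:R * small < (#|V| * d)%:R * tau ^+ r.-1.
  move: Age As; set X := _ * tau ^+ _; rewrite !natrM => Age As.
  have : k%:R * heavy_mass <= k%:R * (2 * small) by rewrite ler_wpM2l ?ler0n.
  lra.
have tau_ge : (d%:R ^+ r)^-1 <= tau.
  rewrite /tau ler_peMl ?invr_ge0 ?(ltW dr_gt0) //.
  by rewrite ler1n (leq_trans _ L_big) // muln_gt0 expn_gt0 r_gt0.
apply: lt_le_trans (_ : (#|V| * d)%:R * ((d%:R ^+ r)^-1) ^+ r.-1 <= _); last first.
  by rewrite ler_wpM2l ?ler0n // lerXn2r ?nnegrE ?tau_ge0 ?invr_ge0 ?(ltW dr_gt0).
move: nd; rewrite -(ltr_nat R) /small (expr_r (_^-1)) !natrM !natrX => nd.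
set D := (d%:R ^+ r)^-1 ^+ r.-1; have D0 : 0 < D by rewrite exprn_gt0 ?invr_gt0.
move: nd; rewrite [d%:R ^+ r.+1]exprS => nd.
have -> (a b c : R) : a * (b * ((d%:R ^+ r)^-1 * D * c))
  = (a * c * b) * (D * (d%:R ^+ r)^-1) by ring.
have -> : #|V|%:R * d%:R * D = (#|V|%:R * (d%:R * d%:R ^+ r)) * (D * (d%:R ^+ r)^-1).
  by field; rewrite gt_eqF.
by rewrite ltr_pM2r // mulr_gt0 ?invr_gt0.
Qed.
End Dominated.

Lemma heavy_card x (S : T) : heavy x S -> (L <= #|[set y | e y x && [forall j, e y (S j)]]|)%N.
Proof.
have dr : 0 < d%:R ^+ r :> R by rewrite exprn_gt0 ?ltr0n.
rewrite /heavy /tau => /le_trans h.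
rewrite -(ler_nat R) -(ler_pM2r (_ : 0 < (d%:R ^+ r)^-1 :> R)) ?invr_gt0 //; apply: h.
rewrite mulr_natl -sumr_const [X in _ <= X]big_mkcond; apply: ler_sum => y _.
rewrite inE /adj; case: (e y x) => /=; last by rewrite mul0r.
rewrite mul1r; case: ifP => [_|/negbT]; first exact: tuplew_le.
rewrite negb_forall => /existsP[j /negPf ny].
by rewrite /tuplew (bigD1 j) //= /stepw /adj ny !mul0r.
Qed.

(** The roots of the centre are [S0], those of satellite [i] are row [i] of [S], and the centres
    come from the set [X] of vertices heavy with every row. Heaviness then leaves at least [L]
    candidates for each satellite. The value [n0] is what [dense_relation] needs to provide more
    than [k * r + l] centres. *)
Lemma heavy_embedding (n0 := ((2 * (4 * (8 * k).+1)) ^ k.+1 * (k * r + l + (k * r) ^ 2)).+1) :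
  (2 * r ^ 2 <= L)%N -> (r + k * r + l + l * k <= L)%N ->
  vol < (8 * k)%:R * heavy_vol heavy ->
  (32 * k * n0 ^ r.+1 * #|V| ^ r < #|V| * d ^ r.+1)%N ->
  blowup_embedding e k r l.
Proof.
move=> L1 L2 hv nd.
have [S0 [S0_inj S0_big dense]] := dense_common L1 hv nd.
have [||S [S_inj SN X_big]] := dense_relation _ _ dense S0_big => //.
  by rewrite muln_gt0 k_gt0.
set X := [set x in _ | _] in X_big.
pose rS := S @: [set: 'I_k * 'I_r]; pose rS0 := S0 @: [set: 'I_r].
have rSc : (#|rS| <= k * r)%N by rewrite (leq_trans (leq_imset_card _ _)) // cardsT card_prod
  !card_ord.
have rS0c : (#|rS0| <= r)%N by rewrite (leq_trans (leq_imset_card _ _)) // cardsT card_ord.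
(* Only the entries of [S] have to be avoided: the centres are adjacent to every [S0 j], so
   irreflexivity keeps them apart from [S0]. *)
have [|x [x_inj xX xS]] := @greedy_representatives V 'I_l (fun=> X) rS.
  by move=> _; rewrite card_ord (leq_trans _ (ltnW X_big)) // leq_add2r.
pose rx := x @: [set: 'I_l].
have rxc : (#|rx| <= l)%N by rewrite (leq_trans (leq_imset_card _ _)) // cardsT card_ord.
pose Z := rS0 :|: rS :|: rx.
have Zc : (#|Z| <= r + k * r + l)%N.
  rewrite (leq_trans (leq_card_setU _ _)) // leq_add //.
  by rewrite (leq_trans (leq_card_setU _ _)) // leq_add.
have [|y [y_inj yA yZ]] := @greedy_representatives V ('I_l * 'I_k)%type
   (fun a => [set y | e y (x a.1) && [forall j, e y (row_of S a.2 j)]]) Z.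
  move=> [j i] /=; rewrite card_prod !card_ord.
  apply: leq_trans (_ : _ <= L)%N _; first by rewrite (leq_trans _ L2) // leq_add2r.
  apply: heavy_card; have := xX j; rewrite inE => /andP[_ /forallP]; exact.
have adjN v j : v \in common S0 -> e (S0 j) v by rewrite inE => /forallP.
have xN j : x j \in common S0 by have := xX j; rewrite inE => /andP[].
have S0Z j : S0 j \in Z by rewrite !inE imset_f.
have SZ a : S a \in Z by rewrite !inE imset_f ?orbT.
have xZ j : x j \in Z by rewrite !inE imset_f ?orbT.
exists (fun a => if a.1 is Some i then S (i, a.2) else S0 a.2),
  (fun j u => if u is Some i then y (j, i) else x j); split.
- case=> [[i|] j] [[i'|] j'] /= E.
  + by case: (S_inj _ _ E) => -> ->.
  + by have := adjN _ j' (SN (i, j)); rewrite E e_irr.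
  + by have := adjN _ j (SN (i', j')); rewrite E e_irr.
  + by rewrite (S0_inj _ _ E).
- move=> j [i|] j' [i'|] E.
  + by case: (y_inj _ _ E) => -> ->.
  + by have := yZ (j, i); rewrite E xZ.
  + by have := yZ (j', i'); rewrite -E xZ.
  + by rewrite (x_inj _ _ E).
- move=> j [i|] [[i'|] j'] /= E.
  + by have := yZ (j, i); rewrite E SZ.
  + by have := yZ (j, i); rewrite E S0Z.
  + by have := xS j; rewrite E imset_f.
  + by have := adjN _ j' (xN j); rewrite E e_irr.
- move=> j [i|] j' /=; last by rewrite e_sym adjN.
  by have := yA (j, i); rewrite inE /= => /andP[_ /forallP/(_ j')]; rewrite ffunE.
- by move=> j i /=; rewrite e_sym; have := yA (j, i); rewrite inE /= => /andP[].
Qed.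
End Weights.

Local Close Scope ring_scope.

(** * Upper bound: conclusion *)

Definition heavy_codegree (k r l : nat) : nat := 2 * r ^ 2 + (r + k * r + l + l * k).
Definition common_size (k r l : nat) : nat :=
  ((2 * (4 * (8 * k).+1)) ^ k.+1 * (k * r + l + (k * r) ^ 2)).+1.
(** The three summands serve in turn the lower bound on [d] in the light case, its counting
    hypothesis, and the counting hypothesis of the heavy case. *)
Definition upper_const (k r l : nat) : nat :=
  (4 * (k ^ 2 + (k.+1 * r) ^ 2)) ^ (k.+1 * r + k)
  + (2 * ((k.+1 * r + l * k.+1) * (k.+1 * heavy_codegree k r l ^ k))).+1
  + (32 * k * common_size k r l ^ r.+1).+1 ^ (k.+1 * r + k).

Lemma min_degree_embedding (V : finType) (e : rel V) (d k r l : nat) :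
  symmetric e -> irreflexive e -> 0 < r -> 0 < k -> 0 < #|V| ->
  (forall x, d <= #|[set y | e x y]|) ->
  upper_const k r l * #|V| ^ (k.+1 * r).-1 <= d ^ (k.+1 * r + k) ->
  blowup_embedding e k r l.
Proof.
move=> e_sym e_irr r_gt0 k_gt0 V_gt0 deg_ge; set b := (k.+1 * r + k).
pose c1 := 4 * (k ^ 2 + (k.+1 * r) ^ 2); pose c3 := 32 * k * common_size k r l ^ r.+1.
pose c2 := 2 * ((k.+1 * r + l * k.+1) * (k.+1 * heavy_codegree k r l ^ k)) => big.
have m_gt0 : 0 < k.+1 * r by rewrite muln_gt0.
have b_gt0 : 0 < b by rewrite addn_gt0 m_gt0.
have big1 c : c ^ b <= upper_const k r l -> c <= d.
  move=> h; rewrite -(leq_exp2r _ _ b_gt0); apply: leq_trans h _; apply: leq_trans big.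
  by rewrite leq_pmulr // expn_gt0 V_gt0.
have d1 : c1 <= d by apply: big1; rewrite /upper_const -/b -/c1 -addnA leq_addr.
have d_gt0 : 0 < d.
  by apply: leq_trans d1; rewrite muln_gt0 /= addn_gt0 expn_gt0 k_gt0.
have d2 : c2 * #|V| ^ (k.+1 * r) < #|V| * d ^ b.
  rewrite -[X in _ ^ X](prednK m_gt0) expnS mulnCA ltn_pmul2l //.
  apply: leq_trans big; rewrite ltn_pmul2r ?expn_gt0 ?V_gt0 //.
  by rewrite /upper_const -/c2 addnAC leq_addl.
have d3 : c3 * #|V| ^ r < #|V| * d ^ r.+1.
  rewrite -[X in _ ^ X](prednK r_gt0) expnS mulnCA ltn_pmul2l //.
  rewrite -(ltn_exp2r _ _ b_gt0) -expnM [r.+1 * b]mulnC expnM.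
  have h : c3.+1 ^ b * (#|V| ^ r.-1) ^ b <= (d ^ b) ^ r.+1.
    apply: leq_trans (_ : (c3.+1 ^ b * #|V| ^ (k.+1 * r).-1) ^ r.+1 <= _); last first.
      rewrite leq_exp2r //; apply: leq_trans big.
      by rewrite leq_pmul2r ?expn_gt0 ?V_gt0 // /upper_const -/c3 -/b leq_addl.
    rewrite expnMn; apply: leq_mul.
      by rewrite expnS leq_pmulr // !expn_gt0.
    (* After raising to the power [b], what remains is [r.-1 * b <= (k.+1 * r).-1 * r.+1]. *)
    rewrite -!expnM leq_pexp2l // /b.
    by case: (r) r_gt0 => // r' _; rewrite mulSn /=; nia.
  apply: leq_trans h; rewrite -expnMn ltn_exp2r // ltn_pmul2r // expn_gt0 V_gt0 //.
pose L := heavy_codegree k r l.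
have [lig|hea] := leP ((8 * k)%:R * heavy_vol rat e (@heavy rat V e d r L))%R (vol rat e).
  exact: (@light_embedding rat _ _ d r k L l).
apply: (@heavy_embedding rat _ _ d r k L l) => //; rewrite /L /heavy_codegree.
  exact: leq_addr.
exact: leq_addl.
Qed.

(** Deleting a vertex of degree below [d] lowers the degree sum by less than [2 * d], so the
    hypothesis survives every deletion and the process stops before the set is empty. *)
Lemma min_degree_subset (V : finType) (e : rel V) (d : nat) : symmetric e ->
  forall A : {set V}, 2 * d * #|A| < \sum_(x in A) #|[set y in A | e x y]| ->
  exists2 B : {set V}, B != set0 & forall x, x \in B -> d <= #|[set y in B | e x y]|.
Proof.
move=> e_sym A; have [m] := ubnP #|A|; elim: m A => // m IH A Am big.
have [/forallP allA|] := boolP [forall x, (x \in A) ==> (d <= #|[set y in A | e x y]|)].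
  exists A; last by move=> x; apply/implyP.
  by apply: contraTneq big => ->; rewrite big_set0.
rewrite negb_forall => /existsP[v]; rewrite negb_imply -ltnNge => /andP[vA dv].
have cA : #|A| = #|A :\ v|.+1 by rewrite (cardsD1 v) vA.
apply: (IH (A :\ v)); first by rewrite -ltnS -cA.
have le1 : \sum_(x in A) #|[set y in A | e x y]| <=
    #|[set y in A | e v y]| + \sum_(x in A :\ v) (#|[set y in A :\ v | e x y]| + e x v).
  rewrite (big_setD1 v) //= leq_add2l; apply: leq_sum => x _.
  rewrite [X in X <= _](cardsD1 v) !inE vA /= addnC leq_add2r.
  by apply: subset_leq_card; apply/subsetP => y; rewrite !inE -andbA.
have le2 : \sum_(x in A :\ v) e x v <= #|[set y in A | e v y]|.
  rewrite -sum1_card [X in X <= _]big_mkcond [X in _ <= X]big_mkcond /=.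
  apply: leq_sum => x _; rewrite !inE e_sym.
  by case: (x \in A); case: (e v x); case: (x == v).
move: big le1; rewrite big_split /= cA; lia.
Qed.

Lemma sum_card_section (S T : finType) (g : S * T -> bool) :
  \sum_x #|[set y | g (x, y)]| = #|[set p | g p]|.
Proof.
rewrite -sum1_card (eq_bigl (fun p : S * T => true && g (p.1, p.2))).
  rewrite -(pair_big_dep xpredT (fun x y => g (x, y)) (fun _ _ => 1)) /=.
  by apply: eq_bigr => x _; rewrite sum1dep_card.
by move=> [x y]; rewrite inE.
Qed.

Lemma nedges_double (n : nat) (g : {ffun 'I_n * 'I_n -> bool}) : simple_graph g ->
  \sum_x #|[set y | g (x, y)]| = 2 * nedges g.
Proof.
case/andP=> /forallP g_irr /forallP g_sym.
have gC x y : g (x, y) = g (y, x) by have /forallP/(_ y)/eqP := g_sym x.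
rewrite sum_card_section.
pose sw (p : 'I_n * 'I_n) := (p.2, p.1).
have sw_inj : injective sw by case=> a b [c d] [-> ->].
rewrite -(cardsID [set p : 'I_n * 'I_n | p.1 < p.2] [set p | g p]) mul2n -addnn /nedges.
congr (_ + _); first by apply: eq_card => p; rewrite !inE.
rewrite -[RHS](card_imset _ sw_inj); apply: eq_card => -[x y]; rewrite !inE /=.
apply/andP/imsetP => [[xy gxy]|[[a b]]].
  exists (y, x) => //; rewrite inE /= gC gxy /=; rewrite -leqNgt in xy.
  rewrite ltn_neqAle xy andbT; apply: contraTneq gxy => E.
  by have -> : x = y by [apply: val_inj]; apply: g_irr.
rewrite inE /= => /andP[gab ab] [-> ->]; rewrite gC gab -leqNgt; split=> //; exact: ltnW.
Qed.

Lemma edges_upper (n k r l : nat) (g : {ffun 'I_n * 'I_n -> bool}) :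
  0 < r -> 0 < k -> simple_graph g ->
  ~ blowup_embedding (fun x y => g (x, y)) k r l ->
  nedges g ^ (k.+1 * r + k) <=
    (4 ^ (k.+1 * r + k) * upper_const k r l) * n ^ (2 * (k.+1 * r + k) - k.+1).
Proof.
move=> r_gt0 k_gt0 g_simple no; rewrite leqNgt; apply/negP => big; apply: no.
have := nedges_double g_simple; move: g_simple => /andP[/forallP g_irr /forallP g_sym] dbl.
have e_sym : symmetric (fun x y => g (x, y)) by move=> x y; have /forallP/(_ y)/eqP := g_sym x.
have e_irr : irreflexive (fun x y => g (x, y)) by move=> x; apply/negbTE.
set b := k.+1 * r + k in big *; set m := nedges g in big dbl *.
have m_gt0 : 0 < k.+1 * r by rewrite muln_gt0.
have b_gt0 : 0 < b by rewrite addn_gt0 m_gt0.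
have bE : 2 * b - k.+1 = b + (k.+1 * r).-1 by rewrite /b; lia.
have C_gt0 : 0 < upper_const k r l by rewrite /upper_const addnAC addn_gt0 orbT.
have n_gt0 : 0 < n.
  case: (posnP n) => // n0; move: big; rewrite /m /nedges.
  suff -> : #|[set p : 'I_n * 'I_n | g p && (p.1 < p.2)]| = 0 by rewrite exp0n.
  by apply: eq_card0 => -[x y]; have := ltn_ord x; rewrite {2}n0.
(* With fewer than [2 * n] edges the bound is immediate, as the exponent of [n] is at least [b]. *)
have mn : 2 * n <= m.
  rewrite leqNgt; apply/negP => mn; move: big; rewrite ltnNge => /negP; apply.
  apply: leq_trans (_ : (2 * n) ^ b <= _); first by rewrite leq_exp2r // ltnW.
  rewrite expnMn bE; apply: leq_mul.
    by apply: leq_trans (leq_pmulr _ C_gt0); rewrite leq_exp2r.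
  by rewrite leq_pexp2l // leq_addr.
(* About a quarter of the average degree: small enough for [min_degree_subset], and positive by
   [mn], so rounding down costs at most a factor 2. *)
pose d := m %/ (2 * n).
have d_gt0 : 0 < d by rewrite divn_gt0 // muln_gt0.
have dm : d * (2 * n) <= m by apply: leq_trunc_div.
have md : m < 4 * n * d.
  apply: leq_trans (_ : d.+1 * (2 * n) <= _); first by rewrite ltn_ceil // muln_gt0.
  nia.
have dbig : upper_const k r l * n ^ (k.+1 * r).-1 <= d ^ b.
  have : upper_const k r l * n ^ (k.+1 * r).-1 * (4 * n) ^ b < d ^ b * (4 * n) ^ b.
    rewrite -expnMn [d * _]mulnC; apply: leq_trans (_ : m ^ b < _); last first.
      by rewrite ltn_exp2r.
    rewrite ltnS; apply: leq_trans (ltnW big); rewrite bE expnD expnMn.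
    by rewrite leq_eqVlt; apply/orP; left; apply/eqP; ring.
  by rewrite ltn_pmul2r ?expn_gt0 ?muln_gt0 ?n_gt0 // => /ltnW.
have [|B B0 Bd] := @min_degree_subset _ _ d e_sym setT.
  rewrite cardsT card_ord; under eq_bigl do rewrite inE.
  have -> : \sum_(x < n) #|[set y in setT | g (x, y)]| = 2 * m.
    by rewrite -dbl; apply: eq_bigr => x _; apply: eq_card => y; rewrite !inE.
  by have : 0 < m by [apply: leq_trans mn; rewrite muln_gt0]; lia.
pose V : finType := {x | x \in B}.
have cV : #|V| = #|B| by rewrite card_sig; apply: eq_card => x; rewrite inE.
have V_gt0 : 0 < #|V| by rewrite cV card_gt0.
have [gg [X [h1 h2 h3 h4 h5]]] : blowup_embedding (fun x y : V => g (val x, val y)) k r l.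
  apply: (@min_degree_embedding _ _ d) => //.
  - move=> x; apply: leq_trans (Bd (val x) (valP x)) _.
    rewrite -(card_imset _ val_inj); apply: subset_leq_card; apply/subsetP => y.
    rewrite inE => /andP[yB gy]; apply/imsetP; exists (Sub y yB); by rewrite ?inE ?SubK.
  - apply: leq_trans dbig; rewrite leq_mul2l leq_expl ?orbT //.
    by rewrite cV -[n in _ <= n]card_ord max_card.
exists (fun a => val (gg a)), (fun j u => val (X j u)); split=> //.
- by move=> a a' /val_inj/h1.
- by move=> j u j' u' /val_inj/h2.
- by move=> j u a /val_inj/h3.
Qed.

Local Open Scope ring_scope.

(** * Polynomial functions *)

Section PolyFun.
Variable F : fieldType.
Notation R := {poly F}.

(* Points have coordinates in [F[X]]: the value and the derivative along [v] of a polynomial at [p] are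
   its coefficients of [1] and ['X] at [p + v * 'X]. *)
Definition pev (I : finType) (E : nat) (c : {ffun {ffun I -> 'I_E.+1} -> F}) (y : I -> R) : R :=
  \sum_a (c a)%:P * \prod_i y i ^+ a i.

(** [E] bounds the degree in each variable separately, so there are exactly [E.+1 ^ #|I|] monomials
    to count. *)
Definition polyfun (I : finType) (E : nat) (P : (I -> R) -> R) : Prop :=
  exists c : {ffun {ffun I -> 'I_E.+1} -> F}, forall y, P y = pev c y.

Section Closure.
Variable I : finType.
Implicit Types P Q : (I -> R) -> R.

Lemma polyfun_ext E P Q : polyfun E P -> P =1 Q -> polyfun E Q.
Proof. by case=> c Pc PQ; exists c => y; rewrite -PQ. Qed.

Lemma polyfun_mono E (a : I -> nat) : (forall i, (a i <= E)%N) ->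
  polyfun E (fun y => \prod_i y i ^+ a i).
Proof.
move=> aE; pose b : {ffun I -> 'I_E.+1} := [ffun i => inord (a i)].
exists [ffun x => (x == b)%:R] => y; rewrite /pev (bigD1 b) //= ffunE eqxx mul1r.
rewrite [X in _ + X]big1 ?addr0; last by move=> x /negPf xb; rewrite ffunE xb mul0r.
by apply: eq_bigr => i _; rewrite ffunE inordK // ltnS.
Qed.

Lemma polyfun_scale E (u : F) P : polyfun E P -> polyfun E (fun y => u%:P * P y).
Proof.
case=> c Pc; exists [ffun x => u * c x] => y; rewrite Pc mulr_sumr.
by apply: eq_bigr => x _; rewrite ffunE polyCM mulrA.
Qed.

Lemma polyfun0 E : polyfun E (fun _ : I -> R => 0).
Proof. by exists [ffun=> 0] => y; rewrite /pev big1 // => x _; rewrite ffunE mul0r. Qed.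

Lemma polyfunD E P Q : polyfun E P -> polyfun E Q -> polyfun E (fun y => P y + Q y).
Proof.
case=> c Pc [c' Qc]; exists [ffun x => c x + c' x] => y; rewrite Pc Qc -big_split.
by apply: eq_bigr => x _; rewrite ffunE polyCD mulrDl.
Qed.

Lemma polyfun_sum E (J : finType) (P : J -> (I -> R) -> R) :
  (forall j, polyfun E (P j)) -> polyfun E (fun y => \sum_j P j y).
Proof.
move=> Pj; elim: (index_enum J) => [|j s IH].
  by apply: polyfun_ext (polyfun0 E) _ => y; rewrite big_nil.
by apply: polyfun_ext (polyfunD (Pj j) IH) _ => y; rewrite big_cons.
Qed.

Lemma polyfun_le E E' P : (E <= E')%N -> polyfun E P -> polyfun E' P.
Proof.
move=> EE' [c Pc].
apply: (@polyfun_ext _ (fun y => \sum_a (c a)%:P * \prod_i y i ^+ a i)); last by move=> y;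
  rewrite Pc.
apply: polyfun_sum => a; apply: polyfun_scale; apply: polyfun_mono => i.
by rewrite (leq_trans _ EE') // -ltnS.
Qed.

Lemma polyfunM E E' P Q : polyfun E P -> polyfun E' Q -> polyfun (E + E') (fun y => P y * Q y).
Proof.
case=> c Pc [c' Qc].
apply: (@polyfun_ext _ (fun y => \sum_a \sum_b (c a * c' b)%:P * \prod_i y i ^+ (a i + b i))).
  apply: polyfun_sum => a; apply: polyfun_sum => b; apply: polyfun_scale; apply: polyfun_mono => i.
  by rewrite leq_add // -ltnS.
move=> y; rewrite Pc Qc /pev mulr_suml; apply: eq_bigr => a _; rewrite mulr_sumr.
apply: eq_bigr => b _; rewrite polyCM mulrACA -big_split /=; congr (_ * _).
by apply: eq_bigr => i _; rewrite exprD.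
Qed.

Lemma polyfun_const E (u : F) : polyfun E (fun _ : I -> R => u%:P).
Proof.
apply: polyfun_ext (polyfun_scale u (@polyfun_mono E (fun=> 0%N) _)) _ => // y.
by rewrite big1 ?mulr1.
Qed.

Lemma polyfun_var E i : (0 < E)%N -> polyfun E (fun y : I -> R => y i).
Proof.
move=> E_gt0; apply: polyfun_ext (@polyfun_mono E (fun j => (j == i) : nat) _) _ => [j|y].
  by rewrite (leq_trans (leq_b1 _)).
by rewrite (bigD1 i) //= eqxx big1 ?mulr1 // => j /negPf ->.
Qed.

Lemma polyfunX E n P : polyfun E P -> polyfun (n * E) (fun y => P y ^+ n).
Proof.
move=> Pp; elim: n => [|n IH]; first exact: (polyfun_const _ 1).
by apply: polyfun_ext (polyfunM Pp IH) _ => y; rewrite exprS.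
Qed.

Lemma polyfun_prod E (J : finType) (A : pred J) (P : J -> (I -> R) -> R) :
  (forall j, polyfun E (P j)) -> polyfun (#|J| * E) (fun y => \prod_(j | A j) P j y).
Proof.
move=> Pj; rewrite cardT enumT /index_enum; elim: (Finite.enum J) => [|j s IH].
  by apply: polyfun_ext (polyfun_const _ 1) _ => y; rewrite big_nil.
case Aj: (A j).
  by apply: polyfun_ext (polyfunM (Pj j) IH) _ => y; rewrite big_cons Aj.
by apply: polyfun_ext (polyfun_le (leq_addl _ _) IH) _ => y; rewrite big_cons Aj.
Qed.

End Closure.

Lemma polyfun_comp (I J : finType) E D (P : (J -> R) -> R) (y : J -> (I -> R) -> R) :
  polyfun E P -> (forall j, polyfun D (y j)) ->
  polyfun (#|J| * (E * D)) (fun z => P (fun j => y j z)).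
Proof.
case=> c Pc yj.
apply: (@polyfun_ext _ _ (fun z => \sum_a (c a)%:P * \prod_j y j z ^+ a j)).
  apply: polyfun_sum => a; apply: polyfun_scale; apply: polyfun_prod => j.
  by apply: polyfun_le (polyfunX (a j) (yj j)); rewrite leq_mul2r -ltnS ltn_ord orbT.
by move=> z; rewrite Pc.
Qed.

End PolyFun.

(** * A bound on the number of nonsingular zeros *)

Lemma digits_lt (q n : nat) (f : 'I_n -> nat) : (forall i, (f i < q)%N) ->
  (\sum_i f i * q ^ i < q ^ n)%N.
Proof.
elim: n f => [|n IH] f fq; first by rewrite big_ord0 expn0.
rewrite big_ord_recr /= expnS.
have := IH (fun i => f (widen_ord (leqnSn n) i)) (fun i => fq _).
have := fq ord_max; set S := (\sum_(i < n) _)%N; nia.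
Qed.

Lemma digits_inj (q n : nat) (f g : 'I_n -> nat) :
  (forall i, (f i < q)%N) -> (forall i, (g i < q)%N) ->
  (\sum_i f i * q ^ i = \sum_i g i * q ^ i)%N -> f =1 g.
Proof.
elim: n f g => [|n IH] f g fq gq; first by move=> _ [].
rewrite !big_ord_recr /=.
have := digits_lt (fun i => fq (widen_ord (leqnSn n) i)).
have := digits_lt (fun i => gq (widen_ord (leqnSn n) i)).
set Sf := (\sum_(i < n) f _ * _)%N; set Sg := (\sum_(i < n) g _ * _)%N => Sgq Sfq E.
have fg : f ord_max = g ord_max by nia.
have SE : Sf = Sg by move: E; rewrite fg; lia.
have := IH _ _ (fun i => fq (widen_ord (leqnSn n) i)) (fun i => gq (widen_ord (leqnSn n) i)) SE.
move=> H i; have [j ->|->] := unliftP ord_max i; last exact: fg.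
by have := H j; congr (f _ = g _); apply: val_inj; rewrite /= /bump leqNgt ltn_ord.
Qed.

Section Vanishing.
Variables (F : finFieldType) (K : finType) (A : nat).

(* Kronecker substitution [w_k := z ^ (A.+1 ^ k)] sends distinct monomials to distinct powers of [z]. *)
Lemma vanishing_coefs (H : {ffun K -> 'I_A.+1} -> F) : (A.+1 ^ #|K| <= #|F|)%N ->
  (forall w : K -> F, \sum_a H a * \prod_k w k ^+ a k = 0) -> forall a, H a = 0.
Proof.
move=> FA Hw.
pose code (a : {ffun K -> 'I_A.+1}) := (\sum_(i < #|K|) a (enum_val i) * A.+1 ^ i)%N.
have code_lt a : (code a < A.+1 ^ #|K|)%N by apply: digits_lt => i; apply: ltn_ord.
have code_inj : injective code.
  move=> a b E; apply/ffunP => k; apply: val_inj; rewrite -(enum_rankK k) /=.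
  by apply: (@digits_inj A.+1 _ (fun i => a (enum_val i)) (fun i => b (enum_val i)) _ _ E) => i;
    apply: ltn_ord.
pose p : {poly F} := \sum_a H a *: 'X^(code a).
have coefp a : p`_(code a) = H a.
  rewrite coef_sum (bigD1 a) //= coefZ coefXn eqxx mulr1 big1 ?addr0 // => b ba.
  by rewrite coefZ coefXn (inj_eq code_inj) eq_sym (negPf ba) mulr0.
suff p0 : p = 0 by move=> a; rewrite -coefp p0 coef0.
have sp : (size p <= #|F|)%N.
  apply: leq_trans FA; apply: leq_trans (size_sum _ _ _) _; apply/bigmax_leqP => a _.
  by apply: leq_trans (size_scale_leq _ _) _; rewrite size_polyXn.
apply: (@roots_geq_poly_eq0 _ p (enum F)); last by rewrite -cardE.
  apply/allP => z _; apply/rootP;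
    rewrite horner_sum -[RHS](Hw (fun k => z ^+ (A.+1 ^ enum_rank k))).
  apply: eq_bigr => a _; rewrite hornerZ hornerXn; congr (_ * _).
  rewrite /code expr_sum [RHS](reindex_onto enum_val enum_rank) => [|k _]; last exact: enum_rankK.
  apply: eq_big => [i|i _]; first by rewrite enum_valK eqxx.
  by rewrite enum_valK -exprM mulnC.
exact: enum_uniq.
Qed.
End Vanishing.

Section Bezout.
Variable F : finFieldType.
Notation R := {poly F}.

(** There are more functions than monomials, so the coefficient matrix has a nonzero left kernel
    vector. The relation is one between coefficients and therefore holds at points over [F[X]]
    too. *)
Lemma polyfun_dependent (I M : finType) (E : nat) (Psi : M -> (I -> R) -> R) :
  (forall m, polyfun E (Psi m)) -> (E.+1 ^ #|I| < #|M|)%N ->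
  exists g : M -> F, (exists m, g m != 0) /\ forall y, \sum_m (g m)%:P * Psi m y = 0.
Proof.
move=> Pp card_lt; have [c cP] := fin_all_exists Pp.
pose X : finType := {ffun I -> 'I_E.+1}.
pose C := \matrix_(i < #|M|, j < #|X|) c (enum_val i) (enum_val j).
have : kermx C != 0.
  rewrite -mxrank_eq0 mxrank_ker -lt0n subn_gt0; apply: leq_ltn_trans (rank_leq_col _) _.
  by rewrite card_ffun card_ord.
case/rowV0Pn => u /sub_kermxP uC u0.
have [i ui] : exists i, u 0 i != 0 by apply/rV0Pn.
exists (fun m => u 0 (enum_rank m)); split; first by exists (enum_val i); rewrite enum_valK.
move=> y; under eq_bigr => m _ do rewrite cP /pev mulr_sumr.
rewrite exchange_big big1 // => a _.
under eq_bigr => m _ do rewrite mulrA -polyCM.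
rewrite -mulr_suml -rmorph_sum /=.
suff -> : \sum_m u 0 (enum_rank m) * c m a = 0 by rewrite mul0r.
have /matrixP/(_ 0 (enum_rank a)) := uC; rewrite mxE [RHS]mxE => uCa; rewrite -[RHS]uCa.
rewrite (reindex_onto enum_val enum_rank) => [|k _]; last exact: enum_rankK.
apply: eq_big => [j|j _]; first by rewrite enum_valK eqxx.
by rewrite enum_valK mxE enum_rankK.
Qed.

Definition along (I : finType) (P v : I -> F) (i : I) : R := (P i)%:P + (v i)%:P * 'X.

(** Chosen so that the [A.+1 ^ m.+1] products of a coordinate and the [m] polynomials, each to a
    power at most [A], outnumber the monomials that can occur in them. *)
Definition bezout_bound (m D : nat) : nat := (1 + m * D) ^ m.

(* Each coordinate satisfies an algebraic relation [G] over the [Phi k]; expanding it along a line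
   through a nonsingular zero, its lowest-order part in the [Phi k] must vanish there. *)
Lemma nonsingular_zeros_bound (I K : finType) (D : nat) (Phi : K -> (I -> R) -> R)
    (Z : {set {ffun I -> F}}) (A := bezout_bound #|I| D) :
  #|K| = #|I| -> (forall k, polyfun D (Phi k)) -> (A.+1 ^ #|I| <= #|F|)%N ->
  (forall P, P \in Z -> forall k v, (Phi k (along P v))`_0 = 0) ->
  (forall P, P \in Z -> forall w : K -> F, exists v, forall k, (Phi k (along P v))`_1 = w k) ->
  (#|Z| <= A ^ #|I|)%N.
Proof.
move=> KI Pp FA zero nons.
(* It suffices to confine each coordinate to the roots of a nonzero polynomial of degree at most
   [A]: the zeros then lie in a grid. *)
suff coord i0 : exists2 G : R, G != 0 & (size G <= A.+1)%N /\ forall P, P \in Z -> root G (P i0).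
  have [G G0] := fin_all_exists2 coord => {}coord.
  pose S i := [set x : F | root (G i) x].
  have Sc i : (#|S i| <= A)%N.
    have [sG _] := coord i.
    rewrite -ltnS; apply: leq_trans sG; rewrite cardE.
    apply: max_poly_roots; first exact: G0.
      by apply/allP => x; rewrite mem_enum !inE.
    exact: enum_uniq.
  apply: leq_trans (_ : #|family S| <= _)%N.
    apply: subset_leq_card; apply/subsetP => P PZ; apply/familyP => i.
    by have [_ /(_ P PZ)] := coord i; rewrite !inE.
  rewrite card_family foldrE big_map big_enum /=.
  by rewrite -prod_nat_const; apply: leq_prod => i _.
pose M : finType := ('I_A.+1 * {ffun K -> 'I_A.+1})%type.
pose Psi (m : M) (y : I -> R) := y i0 ^+ m.1 * \prod_k Phi k y ^+ m.2 k.
have [||g [[m0 gm0] gP]] := @polyfun_dependent I M (A + #|K| * (A * D)) Psi.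
- move=> [j a]; rewrite /Psi /=; apply: (polyfunM (P := fun y => y i0 ^+ j)).
    apply: polyfun_le (polyfunX j (polyfun_var F i0 (ltn0Sn 0))).
    by rewrite muln1 -ltnS.
  apply: polyfun_prod => k; apply: polyfun_le (polyfunX (a k) (Pp k)).
  by rewrite leq_mul2r -ltnS ltn_ord orbT.
- rewrite card_prod card_ffun !card_ord KI.
  apply: leq_ltn_trans (_ : (A.+1 * (1 + #|I| * D)) ^ #|I| < _)%N.
    by apply: leq_expl; nia.
  by rewrite expnMn -/(bezout_bound _ _) -/A mulnC ltn_pmul2r ?expn_gt0.
pose wt (m : M) := (\sum_k m.2 k)%N.
(* Among the terms of the relation, one of least total degree [r] in the [Phi k]. *)
have [ms gms msmin] := @arg_minnP M m0 (fun m => g m != 0) wt gm0.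
set r := wt ms in msmin.
pose G a : R := \sum_(j < A.+1) (g (j, a))%:P * 'X^j.
exists (G ms.2).
  apply: contraNneq gms => /polyP/(_ ms.1); rewrite coef0 coef_sum (bigD1 ms.1) //=.
  rewrite coefCM coefXn eqxx mulr1 big1 ?addr0; first by case: (ms) => j a /= ->.
  by move=> j jm; rewrite coefCM coefXn (inj_eq val_inj) eq_sym (negPf jm) mulr0.
split.
  apply: leq_trans (size_sum _ _ _) _; apply/bigmax_leqP => j _.
  by rewrite mul_polyC; apply: leq_trans (size_scale_leq _ _) _; rewrite size_polyXn.
move=> P PZ.
pose H (a : {ffun K -> 'I_A.+1}) : F := if (\sum_k a k == r)%N then (G a).[P i0] else 0.
suff : H ms.2 = 0 by rewrite /H -/(wt ms) eqxx => /rootP.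
apply: vanishing_coefs; first by rewrite KI.
(* By nonsingularity any [w] is the derivative of the [Phi k] along some [v]. Along this line
   [Phi k] is ['X] times a polynomial with value [w k] at 0, so the coefficient of ['X^r] in the
   relation is the lowest-order part at [w]. *)
move=> w; have [v vP] := nons P PZ w.
pose y := along P v; pose B k := drop_poly 1 (Phi k y).
have PhiE k : Phi k y = B k * 'X.
  rewrite -[LHS](poly_take_drop 1) expr1; have -> : take_poly 1 (Phi k y) = 0;
    last by rewrite add0r.
  by apply/polyP => -[|i]; rewrite coef_take_poly coef0 //= zero.
have B0 k : (B k).[0] = w k by rewrite horner_coef0 coef_drop_poly -vP.
have := gP y => /polyP/(_ r); rewrite coef0 coef_sum => gr; rewrite -[RHS]gr {gr}.
have -> : \sum_a H a * \prod_k w k ^+ a k =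
   \sum_(j < A.+1) \sum_(a : {ffun K ->
     'I_A.+1}) (if (\sum_k a k == r)%N then g (j, a) * P i0 ^+ j * \prod_k w k ^+ a k else 0).
  rewrite exchange_big /=; apply: eq_bigr => a _; rewrite /H; case: eqP => _; last first.
    by rewrite mul0r big1.
  rewrite horner_sum mulr_suml; apply: eq_bigr => j _.
  by rewrite hornerM hornerC hornerXn.
rewrite pair_big /=; apply: eq_bigr => -[j a] _ /=.
rewrite coefCM /Psi /=.
have -> : \prod_k Phi k y ^+ a k = \prod_k B k ^+ a k * 'X^(\sum_k a k).
  rewrite expr_sum -big_split /=; apply: eq_bigr => k _; by rewrite PhiE exprMn.
rewrite mulrA coefMXn.
case: ltngtP => [ra|ra|ra].
- by rewrite mulr0.
- have -> : g (j, a) = 0; last by rewrite mul0r.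
  apply/eqP; apply: contraTT ra => ga; rewrite -leqNgt; exact: (msmin (j, a)).
rewrite ra subnn -horner_coef0 hornerM horner_prod horner_exp /y /along hornerD hornerM !hornerC
  hornerX mulr0 addr0 -!mulrA.
congr (_ * (_ * _)); apply: eq_bigr => k _; by rewrite horner_exp B0.
Qed.
End Bezout.

(** * Independence of values and gradients *)

(** Injections between any two fibres force all fibres to have the same size. *)
Lemma card_preim_homogeneous (A B : finType) (f : A -> B) (S : {set B}) :
  (forall y y', exists2 h : A -> A, injective h & forall x, f x = y -> f (h x) = y') ->
  (#|[set x | f x \in S]| * #|B| = #|S| * #|A|)%N.
Proof.
move=> fh; have [y0 _|B0] := pickP B; last first.
  have cB : #|B| = 0%N by apply: eq_card0.
  rewrite cB muln0; have := max_card (mem S); rewrite cB leqn0 => /eqP ->; by rewrite mul0n.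
have fib_le y y' : (#|[set x | f x == y]| <= #|[set x | f x == y']|)%N.
  have [h h_inj fhx] := fh y y'; rewrite -(card_imset _ h_inj); apply: subset_leq_card.
  apply/subsetP => z /imsetP[x]; rewrite inE => /eqP fx ->; by rewrite inE (fhx _ fx).
have fib y : #|[set x | f x == y]| = #|[set x | f x == y0]|.
  by apply/eqP; rewrite eqn_leq !fib_le.
have part (T : {set B}) : #|[set x | f x \in T]| = (#|T| * #|[set x | f x == y0]|)%N.
  rewrite -sum_nat_const -sum1dep_card (partition_big f (mem T)) //=; apply: eq_bigr => y yT.
  rewrite -(fib y) -sum1dep_card; apply: eq_bigl => x.
  by case: eqP => [->|]; rewrite ?yT ?andbF.
have -> : #|A| = #|[set x | f x \in [set: B]]|.
  by rewrite -cardsT; apply: eq_card => x; rewrite !inE.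
by rewrite !part cardsT -mulnA [X in (_ * X)%N]mulnC.
Qed.

Section Jets.
Variables (F : finFieldType) (J : finType).
Notation R := {poly F}.

(** First-order Taylor expansion: the value does not depend on the direction, and the derivative is
    linear in it. *)
Definition jet (P : (J -> R) -> R) : Prop :=
  exists (f : (J -> F) -> F) (g : (J -> F) -> J -> F), forall p v,
    (P (along p v))`_0 = f p /\ (P (along p v))`_1 = \sum_k v k * g p k.

Lemma jet_const u : jet (fun=> u%:P).
Proof.
exists (fun=> u), (fun _ _ => 0) => p v; rewrite !coefC; split=> //.
by rewrite big1 // => k _; rewrite mulr0.
Qed.

Lemma jet_var i : jet (fun y => y i).
Proof.
exists (fun p => p i), (fun _ k => (k == i)%:R) => p v; rewrite /along !coefD !coefC !coefCM !coefX.
rewrite mulr0 addr0 mulr1 add0r; split=> //.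
by rewrite (bigD1 i) //= eqxx mulr1 big1 ?addr0 // => k /negPf ->; rewrite mulr0.
Qed.

Lemma jetM P Q : jet P -> jet Q -> jet (fun y => P y * Q y).
Proof.
move=> [f [g PP]] [f' [g' QQ]].
exists (fun p => f p * f' p), (fun p k => f p * g' p k + g p k * f' p) => p v.
have [P0 P1] := PP p v; have [Q0 Q1] := QQ p v.
split; first by rewrite coefM big_ord1 P0 Q0.
rewrite coefM big_ord_recl big_ord1 /= P0 P1 Q0 Q1 mulr_sumr mulr_suml -big_split /=.
by apply: eq_bigr => k _; ring.
Qed.

Lemma jet_ext P Q : jet P -> P =1 Q -> jet Q.
Proof. by move=> [f [g PP]] PQ; exists f, g => p v; rewrite -PQ. Qed.

Lemma jetD P Q : jet P -> jet Q -> jet (fun y => P y + Q y).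
Proof.
move=> [f [g PP]] [f' [g' QQ]].
exists (fun p => f p + f' p), (fun p k => g p k + g' p k) => p v.
have [P0 P1] := PP p v; have [Q0 Q1] := QQ p v.
rewrite !coefD P0 P1 Q0 Q1 -big_split /=; split=> //.
by apply: eq_bigr => k _; ring.
Qed.

Lemma jet_pev E (c : {ffun {ffun J -> 'I_E.+1} -> F}) : jet (pev c).
Proof.
have jetX n i : jet (fun y => y i ^+ n).
  elim: n => [|n IH]; first exact: (jet_const 1).
  by apply: jet_ext (jetM (jet_var i) IH) _ => y; rewrite exprS.
rewrite /pev; elim: (index_enum _) => [|a s IH].
  by apply: jet_ext (jet_const 0) _ => y; rewrite big_nil.
apply: jet_ext (jetD (jetM (jet_const (c a)) (_ : jet (fun y => \prod_i y i ^+ a i))) IH) _;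
  last first.
  by move=> y; rewrite big_cons.
elim: (index_enum _) => [|i r IHr].
  by apply: jet_ext (jet_const 1) _ => y; rewrite big_nil.
by apply: jet_ext (jetM (jetX (a i) i) IHr) _ => y; rewrite big_cons.
Qed.

Definition unit_dir (k : J) (i : J) : F := (i == k)%:R.

Section Data.
Variable E : nat.
Notation Cf := {ffun {ffun J -> 'I_E.+1} -> F}.

Definition pdat (c : Cf) (p : J -> F) (o : option J) : F :=
  if o is Some k then (pev c (along p (unit_dir k)))`_1 else (pev c (along p (fun=> 0)))`_0.

Lemma pev_coef0 (c : Cf) p v : (pev c (along p v))`_0 = pdat c p None.
Proof. by have [f [g PP]] := jet_pev c; rewrite /pdat !(proj1 (PP _ _)). Qed.

Lemma pev_coef1 (c : Cf) p v : (pev c (along p v))`_1 = \sum_k v k * pdat c p (Some k).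
Proof.
have [f [g PP]] := jet_pev c; rewrite (proj2 (PP _ _)); apply: eq_bigr => k _; congr (_ * _).
rewrite /pdat (proj2 (PP _ _)) (bigD1 k) //= /unit_dir eqxx mul1r big1 ?addr0 //.
by move=> i /negPf ->; rewrite mul0r.
Qed.

Lemma pdatD (c c' : Cf) p o : pdat (c + c') p o = pdat c p o + pdat c' p o.
Proof.
have pevD y : pev (c + c') y = pev c y + pev c' y.
  by rewrite /pev -big_split; apply: eq_bigr => a _; rewrite ffunE polyCD mulrDl.
by case: o => [k|]; rewrite /pdat pevD coefD.
Qed.

(** For each point, a product of squared linear factors kills values and gradients at all other
    points; an affine factor then prescribes them at the point itself. The degree is at most
    [#|Q| * 2 + 1]. *)
Lemma hermite_interpolation (Q : finType) (pts : Q -> {ffun J -> F}) (dl : Q -> option J -> F) :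
  injective pts -> (#|Q| * 2 < E)%N ->
  exists c : Cf, forall q o, pdat c (pts q) o = dl q o.
Proof.
move=> pts_inj QE.
pose sep q q' := [pick k | pts q k != pts q' k].
pose fac q q' (y : J -> R) : R := if sep q q' is Some k then (y k - (pts q' k)%:P) ^+ 2 else 1.
pose B q (y : J -> R) : R := \prod_(q' | q' != q) fac q q' y.
have polyB q : polyfun (#|Q| * 2) (B q).
  apply: polyfun_prod => q'; rewrite /fac; case: (sep q q') => [k|];
    last exact: (@polyfun_const F J _ 1).
  apply: polyfun_ext (polyfunX 2 (polyfunD (polyfun_var F k (ltn0Sn 0)) (@polyfun_const F J _ (-
    pts q' k)))) _.
  by move=> y; rewrite polyCN.
have jetB q : jet (B q).
  have [c Bc] := polyB q; by apply: jet_ext (jet_pev c) _ => y; rewrite Bc.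
have sepP q q' : q' != q -> exists2 k, sep q q' = Some k & pts q k != pts q' k.
  move=> qq'; rewrite /sep; case: pickP => [k h|same]; first by exists k.
  case/eqP: qq'; apply: pts_inj; apply/ffunP => k; apply/eqP.
  by have /negbT := same k; rewrite negbK eq_sym.
have B_far q q' v : q' != q -> exists T, B q (along (pts q') v) = T * 'X^2.
  move=> qq'; rewrite /B (bigD1 q') //= /fac; have [k -> _] := sepP _ _ qq'.
  rewrite /along addrAC subrr add0r exprMn.
  by eexists; rewrite mulrAC.
pose b0 q := (B q (along (pts q) (fun=> 0)))`_0.
have b0E q v : (B q (along (pts q) v))`_0 = b0 q.
  by have [f [g PP]] := jetB q; rewrite /b0 !(proj1 (PP _ _)).
have b0_neq0 q : b0 q != 0.
  rewrite /b0 -horner_coef0 horner_prod; apply/prodf_neq0 => q' qq'.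
  rewrite /fac; have [k -> h] := sepP _ _ qq'.
  rewrite horner_exp /along !hornerE expf_neq0 // subr_eq0 //.
pose b1 q k := (B q (along (pts q) (unit_dir k)))`_1.
(* By the product rule the system for the affine factor is triangular: [u] is determined by the
   value, then [a] by the partial derivatives. *)
pose u q := dl q None / b0 q.
pose a q k := (dl q (Some k) - u q * b1 q k) / b0 q.
pose aff q (y : J -> R) := (u q)%:P + \sum_k (a q k)%:P * (y k - (pts q k)%:P).
have poly_aff q : polyfun 1 (aff q).
  apply: polyfunD; first exact: polyfun_const.
  apply: polyfun_sum => k; apply: polyfun_scale.
  apply: polyfun_ext (polyfunD (polyfun_var F k (ltn0Sn 0)) (@polyfun_const F J _ (- pts q k))) _.
  by move=> y; rewrite polyCN.
have [c cP] : polyfun E (fun y => \sum_q B q y * aff q y).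
  apply: polyfun_sum => q; apply: polyfun_le (polyfunM (polyB q) (poly_aff q)).
  by rewrite addn1.
have affE q v : aff q (along (pts q) v) = (u q)%:P + (\sum_k a q k * v k)%:P * 'X.
  rewrite /aff rmorph_sum mulr_suml /=; congr (_ + _); apply: eq_bigr => k _.
  by rewrite /along addrAC subrr add0r mulrA -polyCM.
have sumE q v i : (i < 2)%N -> (pev c (along (pts q) v))`_i
  = (B q (along (pts q) v) * aff q (along (pts q) v))`_i.
  move=> i2; rewrite -cP coef_sum (bigD1 q) //= big1 ?addr0 // => q' qq'.
  have [|T ->] := B_far q' q v; first by rewrite eq_sym.
  by rewrite mulrAC coefMXn i2.
exists c => q [k|]; rewrite /pdat sumE // affE.
  rewrite coefM big_ord_recl big_ord1 /= !coefD !coefC !coefCM !coefX /= b0E -/(b1 q k).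
  rewrite mulr0 addr0 mulr1 add0r (bigD1 k) //= /unit_dir eqxx mulr1 big1 ?addr0; last first.
    by move=> i /negPf ->; rewrite mulr0.
  by rewrite /a; field; apply: b0_neq0.
rewrite coefM big_ord1 /= coefD coefC coefCM coefX /= mulr0 addr0 b0E /u.
by rewrite mulrC divfK.
Qed.

(** Evaluation of values and gradients is additive and, by interpolation, surjective; hence it is
    equidistributed for uniformly random coefficients. *)
Lemma card_pdat (W Q : finType) (pts : Q -> {ffun J -> F})
    (S : {set {ffun Q * W -> {ffun option J -> F}}}) :
  injective pts -> (#|Q| * 2 < E)%N ->
  (#|[set c : {ffun W -> Cf} | [ffun qw => [ffun o => pdat (c qw.2) (pts qw.1) o]] \in S]|
     * #|{: {ffun Q * W -> {ffun option J -> F}}}| = #|S| * #|{: {ffun W -> Cf}}|)%N.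
Proof.
move=> pts_inj QE.
pose f (c : {ffun W -> Cf}) : {ffun Q * W -> {ffun option J -> F}} :=
  [ffun qw => [ffun o => pdat (c qw.2) (pts qw.1) o]].
have fD c c' : f (c + c') = f c + f c'.
  by apply/ffunP => -[q w]; apply/ffunP => o; rewrite !ffunE pdatD.
have f_surj dl : exists c, f c = dl.
  have H w : exists c : Cf, forall q o, pdat c (pts q) o = dl (q, w) o.
    exact: (hermite_interpolation (fun q => dl (q, w))).
  have [c cP] := fin_all_exists H.
  by exists [ffun w => c w]; apply/ffunP => -[q w]; apply/ffunP => o; rewrite !ffunE cP.
apply: (@card_preim_homogeneous _ _ f) => y y'; have [c fc] := f_surj (y' - y).
exists (fun x => x + c); first exact: addIr.
by move=> x fx; rewrite fD fx fc addrC subrK.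
Qed.
End Data.
End Jets.

(** * The system defining the copies of the tree *)

Lemma eq_pev (F : fieldType) (I : finType) E (c : {ffun {ffun I -> 'I_E.+1} -> F}) (y z : I ->
  {poly F}) :
  y =1 z -> pev c y = pev c z.
Proof. by move=> yz; apply: eq_bigr => a _; congr (_ * _); apply: eq_bigr => i _; rewrite yz. Qed.

Section TreeSystem.
Variables (F : finFieldType) (r k : nat).
Notation U := (option 'I_k).
(* A vertex of the graph has as many coordinates as the tree has edges, see [card_coord]. *)
Definition coord : finType := ('I_r * option 'I_k + 'I_k)%type.
(** [inl (u, j)] joins the inner vertex [u] to its root [j], and [inr i] joins the centre to
    satellite [i]. *)
Definition tedge : finType := (option 'I_k * 'I_r + 'I_k)%type.
Notation J := (bool * coord)%type.
Notation I := (U * coord)%type.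
Notation K := (tedge * U)%type.

Lemma card_coord : #|coord| = (k.+1 * r + k)%N.
Proof. by rewrite /coord card_sum card_prod card_option !card_ord mulnC. Qed.

(* Row [kp] of the Jacobian is matched with the unknown [eqvar kp]: the satellite [Some i] absorbs
   all but one of the equations of the edge joining it to the centre. *)
Definition eqvar (kp : K) : I :=
  match kp with
  | (inl (u, j), w) => (u, inl (j, w))
  | (inr i, None) => (None, inr i)
  | (inr i, Some i') => (Some i, inr i')
  end.
Definition vareq (i : I) : K :=
  match i with
  | (u, inl (j, w)) => (inl (u, j), w)
  | (None, inr i) => (inr i, None)
  | (Some i, inr i') => (inr i, Some i')
  end.
Lemma eqvarK : cancel eqvar vareq.
Proof. by case=> [[[[u|] j]|i] [w|]]. Qed.
Lemma vareqK : cancel vareq eqvar.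
Proof. by case=> [[u|] [[j w]|i]]. Qed.
Lemma card_eq_var : #|{: K}| = #|{: I}|.
Proof. exact: bij_eq_card (Bijective eqvarK vareqK). Qed.

Section Fixed.
Variable sg : U -> bool.

(** A pair of vertices from opposite sides is one point indexed by side and coordinate, with [sg u]
    the side of [u]. The type [S] is [F] for points and directions, and [{poly F}] for the system
    along a line. *)
Definition edge_pt (S : Type) (g : U * 'I_r -> coord -> S) (y : I -> S) (ep : tedge) (x : J) : S :=
  match ep with
  | inl a => if x.1 == sg a.1 then y (a.1, x.2) else g a x.2
  | inr i => if x.1 == sg None then y (None, x.2) else y (Some i, x.2)
  end.

Definition edge_dir (v : I -> F) : tedge -> J -> F := edge_pt (fun _ _ => 0) v.

Lemma edge_pt_along (g : U * 'I_r -> coord -> F) (P v : I -> F) ep :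
  edge_pt (fun a x => (g a x)%:P) (along P v) ep =1 along (edge_pt g P ep) (edge_dir v ep).
Proof.
case: ep => [a|i] x; rewrite /along /edge_dir /=; case: ifP => _ //.
by rewrite mul0r addr0.
Qed.

Notation Gd := {ffun K -> {ffun J -> F}}.

Definition lin (G : Gd) (v : I -> F) (kp : K) : F := \sum_x edge_dir v kp.1 x * G kp x.

Definition surj (G : Gd) : bool :=
  [forall w : {ffun K -> F}, [exists v : {ffun I -> F}, [forall kp, lin G v kp == w kp]]].

(** The gradients whose Jacobian is the identity under the matching [eqvar], as [lin_shift]
    shows. *)
Definition unit_grad (kp : K) (x : J) : F :=
  match kp with
  | (inl (u, j), w) => (x == (sg u, inl (j, w)))%:R
  | (inr i, None) => (x == (sg None, inr i))%:R
  | (inr i, Some i') => (x == (~~ sg None, inr i'))%:R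
  end.

Definition shift_grad (G : Gd) (z : F) : Gd := [ffun kp => [ffun x => G kp x + z * unit_grad kp x]].

Lemma lin_sum (G : Gd) (v : I -> F) kp : lin G v kp = \sum_i v i * lin G (fun i' =>
  (i' == i)%:R) kp.
Proof.
rewrite /lin; under [RHS]eq_bigr => i _ do rewrite mulr_sumr.
rewrite exchange_big; apply: eq_bigr => x _ /=.
under eq_bigr => i _ do rewrite mulrA; rewrite -mulr_suml; congr (_ * _).
have pick j : v j = \sum_i v i * (j == i)%:R.
  rewrite (bigD1 j) //= eqxx mulr1 big1 ?addr0 // => i /negPf ij.
  by rewrite eq_sym ij mulr0.
case: kp => -[a|i] w; rewrite /edge_dir /=; case: ifP => _ //.
by rewrite big1 // => i _; rewrite mulr0.
Qed.

Lemma lin_shift (G : Gd) z (v : I ->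
  F) kp : lin (shift_grad G z) v kp = lin G v kp + z * v (eqvar kp).
Proof.
rewrite /lin; under eq_bigr => x _ do rewrite !ffunE mulrDr.
rewrite big_split /=; congr (_ + _).
have one (x0 : J) (h : J -> F) : \sum_x h x * (z * (x == x0)%:R) = z * h x0.
  rewrite (bigD1 x0) //= eqxx mulr1 big1 ?addr0; first by rewrite mulrC.
  by move=> x /negPf ->; rewrite !mulr0.
case: kp => -[[u j]|i] [i'|]; rewrite /unit_grad one /edge_dir /= ?eqxx //.
by case: (sg None).
Qed.

(* Shifting the gradients by [z * unit_grad] adds the scalar matrix [z] to the Jacobian, so the bad [z] are
   opposites of roots of a characteristic polynomial. *)
Lemma singular_few (G : Gd) : (#|[set z | ~~ surj (shift_grad G z)]| <= #|{: I}|)%N.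
Proof.
pose m := #|{: I}|.
pose M : 'M[F]_m := \matrix_(i, j) lin G (fun i' => (i' == enum_val i)%:R) (vareq (enum_val j)).
have Mz z : ~~ surj (shift_grad G z) -> root (char_poly M) (- z).
  apply: contraNT => nroot.
  have Mu : M + z%:M \in unitmx.
    move: nroot; rewrite -eigenvalue_root_char /eigenvalue /eigenspace negbK.
    by rewrite raddfN opprK -row_free_unit -kermx_eq0.
  apply/forallP => w; apply/existsP.
  pose wr : 'rV[F]_m := \row_j w (vareq (enum_val j)).
  pose v := wr *m invmx (M + z%:M).
  exists [ffun i => v 0 (enum_rank i)]; apply/forallP => kp; apply/eqP.
  have /matrixP/(_ 0 (enum_rank (eqvar kp))) : v *m (M + z%:M) = wr by rewrite mulmxKV.
  rewrite !mxE enum_rankK eqvarK => <-.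
  rewrite lin_shift lin_sum ffunE.
  under [RHS]eq_bigr => j _ do rewrite [X in _ * X]mxE mulrDr.
  rewrite big_split /=; congr (_ + _).
    rewrite (reindex_onto enum_val enum_rank) => [|i _]; last exact: enum_rankK.
    apply: eq_big => [j|j _]; first by rewrite enum_valK eqxx.
    by rewrite [X in _ = _ * X]mxE ffunE enum_valK enum_rankK eqvarK.
  rewrite (bigD1 (enum_rank (eqvar kp))) //= [X in _
    = _ * X + _]mxE eqxx mulr1n mulrC big1 ?addr0 //.
  by move=> j /negPf jN; rewrite [X in _ * X]mxE jN mulr0n mulr0.
have -> : #|[set z | ~~ surj (shift_grad G z)]| = #|(-%R : F ->
  F) @: [set z | ~~ surj (shift_grad G z)]|.
  by rewrite card_imset //; apply: oppr_inj.
rewrite -ltnS -[X in (_ < X)%N](size_char_poly M) cardE.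
apply: max_poly_roots; last exact: enum_uniq.
  by rewrite monic_neq0 ?char_poly_monic.
by apply/allP => z; rewrite mem_enum => /imsetP[z']; rewrite inE => /Mz rz ->.
Qed.

Definition singular : {set Gd} := [set G | ~~ surj G].

(** Translation by [z * unit_grad] permutes the gradients, so all translates of the singular set
    have equal size. Summing over [z] and applying [singular_few] to each [G] gives the proportion
    [#|I| / #|F|]. *)
Lemma card_singular : (#|singular| * #|F| <= #|{: I}| * #|{: Gd}|)%N.
Proof.
have shift_bij z : #|[set G | ~~ surj (shift_grad G z)]| = #|singular|.
  have inj : injective (fun G : Gd => shift_grad G z).
    move=> G G' /ffunP E; apply/ffunP => kp; apply/ffunP => x.
    by have /ffunP/(_ x) := E kp; rewrite !ffunE => /addIr.
  rewrite -[LHS](card_imset _ inj); apply: eq_card => G; rewrite inE.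
  have [inv Kinv invK] := injF_bij inj.
  apply/imsetP/idP => [[G' ]|hG]; first by rewrite inE => h ->.
  by exists (inv G); rewrite ?inE invK.
have -> : (#|singular| * #|F| = \sum_(z : F) #|[set G | ~~ surj (shift_grad G z)]|)%N.
  by under eq_bigr do rewrite shift_bij; rewrite sum_nat_const mulnC.
under eq_bigr => z _ do rewrite -sum1dep_card big_mkcond /=.
rewrite exchange_big /= mulnC -sum_nat_const; apply: leq_sum => G _.
by rewrite -big_mkcond sum1dep_card singular_few.
Qed.

Section Copies.
Variables (E n : nat).
Notation Cf := {ffun {ffun J -> 'I_E.+1} -> F}.
Variable g : U * 'I_r -> coord -> F.

Definition system (c : {ffun U -> Cf}) (kp : K) (y : I -> {poly F}) : {poly F} :=
  pev (c kp.2) (edge_pt (fun a x => (g a x)%:P) y kp.1).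

Definition edge_point (P : I -> F) (ep : tedge) : {ffun J -> F} := [ffun x => edge_pt g P ep x].
Definition grad (c : {ffun U -> Cf}) (P : I -> F) : Gd :=
  [ffun kp => [ffun x => pdat (c kp.2) (edge_point P kp.1) (Some x)]].
Definition is_zero (c : {ffun U -> Cf}) (P : I -> F) : bool :=
  [forall kp : K, pdat (c kp.2) (edge_point P kp.1) None == 0].

Lemma eq_along (T : finType) (p p' v v' : T -> F) : p =1 p' -> v =1 v' -> along p v =1 along p' v'.
Proof. by move=> pp vv i; rewrite /along pp vv. Qed.

Lemma system_along c kp P v :
  system c kp (along P v) = pev (c kp.2) (along (edge_point P kp.1) (edge_dir v kp.1)).
Proof.
apply: eq_pev => x; rewrite edge_pt_along; apply: eq_along => // i.
by rewrite ffunE.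
Qed.

Lemma system_coef0 c kp P v : is_zero c P -> (system c kp (along P v))`_0 = 0.
Proof. by move=> /forallP/(_ kp)/eqP z; rewrite system_along pev_coef0. Qed.

Lemma system_coef1 c kp P v : (system c kp (along P v))`_1 = lin (grad c P) v kp.
Proof.
by rewrite system_along pev_coef1 /lin; apply: eq_bigr => x _; rewrite !ffunE.
Qed.

Lemma system_polyfun c kp : polyfun (#|{: J}| * E) (system c kp).
Proof.
have H : forall x, polyfun 1 (fun y : I -> {poly F} => edge_pt (fun a x => (g a x)%:P) y kp.1 x).
  move=> x; case: kp => -[a|i] w /=.
    by case: (x.1 == sg a.1); [apply: polyfun_var | apply: polyfun_const].
  by case: (x.1 == sg None); apply: polyfun_var.
have C : polyfun E (pev (c kp.2)) by exists (c kp.2).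
by have := polyfun_comp C H; rewrite muln1.
Qed.

Lemma nonsingular_copies c (Z : {set {ffun I -> F}})
    (A := bezout_bound #|{: I}| (#|{: J}| * E)) : (A.+1 ^ #|{: I}| <= #|F|)%N ->
  (forall P : {ffun I -> F}, P \in Z -> is_zero c P && surj (grad c P)) -> (#|Z| <= A ^ #|{: I}|)%N.
Proof.
move=> FA ZP; apply: (@nonsingular_zeros_bound F I K _ (system c)) => //.
- exact: card_eq_var.
- by move=> kp; apply: system_polyfun.
- by move=> P /ZP/andP[z _] kp v; apply: system_coef0.
- move=> P /ZP/andP[_ /forallP s] w; have /existsP[v /forallP vP] := s [ffun kp => w kp].
  by exists v => kp; rewrite system_coef1 (eqP (vP kp)) ffunE.
Qed.

(** At distinct points values and gradients are uniform and independent: the vanishing of all values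
    costs [#|F| ^ (n * #|K|)], and each of the [n] singular Jacobians costs one more factor [#|F|],
    up to [#|I|]. *)
Lemma singular_copies (X : 'I_n -> {ffun I -> F}) :
  injective (fun q : 'I_n * tedge => edge_point (X q.1) q.2) -> (n * #|tedge| * 2 < E)%N ->
  (#|[set c : {ffun U -> Cf} | [forall a, is_zero c (X a) && ~~ surj (grad c (X a))]]|
     * #|F| ^ (n * (#|{: K}| + 1)) <= #|{: I}| ^ n * #|{: {ffun U -> Cf}}|)%N.
Proof.
move=> inj nE.
pose Q : finType := ('I_n * tedge)%type.
pose gpart (dl : {ffun Q * U -> {ffun option J -> F}}) (a : 'I_n) : Gd :=
  [ffun kp => [ffun x => dl ((a, kp.1), kp.2) (Some x)]].
pose S := [set dl : {ffun Q * U -> {ffun option J -> F}} |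
  [forall q, dl q None == 0] && [forall a, gpart dl a \in singular]].
have := @card_pdat F J E U Q (fun q => edge_point (X q.1) q.2) S inj _.
rewrite card_prod card_ord => /(_ nE).
set N := #|[set c : {ffun U -> Cf} | _ \in S]|.
have -> : #|[set c : {ffun U -> Cf} | [forall a, is_zero c (X a) && ~~ surj (grad c (X a))]]| = N.
  apply: eq_card => c; rewrite !inE; apply/forallP/andP => [h|[/forallP h1 /forallP h2] a].
    split; apply/forallP.
      move=> [[a ep] w]; rewrite !ffunE; have /andP[/forallP/(_ (ep, w)) hz _] := h a.
      exact: hz.
    move=> a; have /andP[_] := h a; rewrite inE; apply: contra.
    by congr (is_true (surj _)); apply/ffunP => kp; apply/ffunP => x; rewrite !ffunE.
  apply/andP; split.
    by apply/forallP => -[ep w]; have := h1 ((a, ep), w); rewrite !ffunE.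
  have := h2 a; rewrite inE; apply: contra.
  by congr (is_true (surj _)); apply/ffunP => kp; apply/ffunP => x; rewrite !ffunE.
have S_le : (#|S| <= #|singular| ^ n)%N.
  rewrite -[n in (_ ^ n)%N]card_ord -card_ffun_on.
  have inS : {in S &, injective (fun dl => [ffun a => gpart dl a])}.
    move=> dl dl'; rewrite !inE => /andP[/forallP z _] /andP[/forallP z' _] /ffunP E'.
    apply/ffunP => -[[a ep] w]; apply/ffunP => -[x|]; last by rewrite (eqP (z _)) (eqP (z' _)).
    by have := E' a; rewrite !ffunE => /ffunP/(_ (ep, w)); rewrite !ffunE => /ffunP/(_ x);
      rewrite !ffunE.
  rewrite -(card_in_imset inS); apply: subset_leq_card; apply/subsetP => f /imsetP[dl].
  rewrite inE => /andP[_ /forallP sdl] ->; apply/ffun_onP => a; by rewrite ffunE.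
have -> : #|{: {ffun Q * U -> {ffun option J -> F}}}| = (#|F| ^ (n * #|{: K}|) * #|{: Gd}| ^ n)%N.
  rewrite !card_ffun card_option !card_prod card_ord -!expnM -expnD; congr (_ ^ _)%N.
  ring.
move=> NE; have Gd_gt0 : (0 < #|{: Gd}| ^ n)%N.
  by rewrite expn_gt0; apply/orP; left; apply/card_gt0P; exists [ffun=> [ffun=> 0]].
rewrite -(leq_pmul2r Gd_gt0).
apply: leq_trans (_ : #|S| * #|{: {ffun U -> Cf}}| * #|F| ^ n <= _)%N.
  by rewrite -NE mulnDr muln1 expnD !mulnA mulnAC.
apply: leq_trans (_ : (#|singular| * #|F|) ^ n * #|{: {ffun U -> Cf}}| <= _)%N.
  by rewrite expnMn mulnAC leq_mul2r leq_mul2r S_le !orbT.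
by rewrite mulnAC leq_mul2r -expnMn (leq_expl _ card_singular) orbT.
Qed.
End Copies.
End Fixed.
End TreeSystem.

(** * Lower bound: the random algebraic graph *)

Section RandomGraph.
Variables (F : finFieldType) (r k : nat).
Notation U := (option 'I_k).
Notation coord := (coord r k).
Notation tedge := (tedge r k).
Notation J := (bool * coord)%type.
Notation I := (U * coord)%type.
Notation K := (tedge * U)%type.
Notation Vt := (bool * {ffun coord -> F})%type.

(* One more than the exponent of [q] lost to the union bound over the roots and to the edge density. *)
Definition ncopies : nat := #|coord| * (k.+1 * r) + k.+2.
(** The degree that interpolation at the edge points of [ncopies] copies requires. *)
Definition rdegree : nat := (ncopies * #|tedge| * 2).+1.
Definition max_nonsingular : nat := bezout_bound #|{: I}| (#|{: J}| * rdegree).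
Definition max_copies : nat := max_nonsingular ^ #|{: I}| + ncopies.
(** The first summand makes the field large enough for the Bezout bound, the second lets one spare
    factor [q] beat the constants of the union bound. *)
Definition min_field : nat :=
  (max_nonsingular.+1 ^ #|{: I}| + 2 ^ (k.+1 * r).+1 * #|{: I}| ^ ncopies).+1.

Notation Cf := {ffun {ffun J -> 'I_rdegree.+1} -> F}.
Notation Cs := {ffun U -> Cf}.

Definition vanish (c : Cs) (p : {ffun J -> F}) : bool := [forall w, pdat (c w) p None == 0].
Definition pairpt (v v' : Vt) : {ffun J -> F} :=
  [ffun x => if x.1 == v.1 then v.2 x.2 else v'.2 x.2].
Definition gadj (c : Cs) : rel Vt := fun v v' => (v.1 != v'.1) && vanish c (pairpt v v').

Lemma pairptC v v' : v.1 != v'.1 -> pairpt v v' = pairpt v' v.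
Proof.
move=> vv; apply/ffunP => -[b x]; rewrite !ffunE /=.
by case: b; move: vv; case: v.1; case: v'.1.
Qed.

Lemma pairpt_inj v v' u u' : v.1 != v'.1 -> u.1 != u'.1 -> pairpt v v' = pairpt u u' ->
  (v = u /\ v' = u') \/ (v = u' /\ v' = u).
Proof.
wlog vu : u u' / v.1 = u.1.
  move=> H vv uu; have [E|E] := eqVneq v.1 u.1; first exact: H.
  rewrite (pairptC uu) => pE; have [||[-> ->]|[-> ->]] := H u' u _ vv _ pE.
  - by move: vv uu E; case: v.1; case: v'.1; case: u.1; case: u'.1.
  - by rewrite eq_sym.
  - by right.
  - by left.
move=> vv uu /ffunP pE; left.
have vu' : v'.1 = u'.1 by move: vv uu vu; case: v.1; case: v'.1; case: u.1; case: u'.1.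
case: v v' u u' vv uu vu vu' pE => [b x] [b' x'] [d y] [d' y'] /= vv uu <- <- pE.
split; congr (_, _); apply/ffunP => z.
  by have := pE (b, z); rewrite !ffunE /= eqxx.
by have := pE (b', z); rewrite !ffunE /= eq_sym (negPf vv).
Qed.

Lemma gadj_sym c : symmetric (gadj c).
Proof.
move=> v v'; rewrite /gadj eq_sym; case: eqP => //= /eqP vv.
by rewrite pairptC // eq_sym.
Qed.

Lemma gadj_irr c : irreflexive (gadj c).
Proof. by move=> v; rewrite /gadj eqxx. Qed.

(** An inner vertex lies opposite to its roots, so any one of them determines its side; the default
    [false] arises only for [r = 0]. *)
Definition side (g : {ffun U * 'I_r -> Vt}) (u : U) : bool :=
  if [pick j : 'I_r] is Some j then ~~ (g (u, j)).1 else false.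

Definition cfg : finType := ({ffun U * 'I_r -> Vt} * {ffun 'I_ncopies -> {ffun I -> F}})%type.
Definition bad (c : Cs) (x : cfg) : bool :=
  injectiveb (fun q : 'I_ncopies * tedge => edge_point (side x.1) (fun a =>
    (x.1 a).2) (x.2 q.1) q.2)
  && [forall a, is_zero (side x.1) (fun a => (x.1 a).2) c (x.2 a)
       && ~~ surj (side x.1) (grad (side x.1) (fun a => (x.1 a).2) c (x.2 a))].

(** At most [max_nonsingular ^ #|I|] of the copies are nonsingular, so at least [ncopies] singular
    ones remain. Their disjointness outside the roots makes all edge points distinct. *)
Lemma blowup_bad (c : Cs) l : (0 < r)%N -> (max_nonsingular.+1 ^ #|{: I}| <= #|F|)%N ->
  (max_copies <= l)%N -> blowup_embedding (gadj c) k r l -> exists x, bad c x.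
Proof.
move=> r_gt0 FA ll [g0 [X [g_inj X_inj Xg eXg e]]].
pose g : {ffun U * 'I_r -> Vt} := [ffun a => g0 a].
pose sg := side g; pose gp a := (g a).2.
have sgE j u : (X j u).1 = sg u.
  rewrite /sg /side; case: pickP => [i _|]; last by move/(_ (Ordinal r_gt0)).
  by have /andP[] := eXg j u i; rewrite ffunE; case: (X j u).1; case: (g0 _).1.
pose P j : {ffun I -> F} := [ffun i => (X j i.1).2 i.2].
pose ends j (ep : tedge) := match ep with inl a => (X j a.1, g0 a) | inr i =>
  (X j None, X j (Some i)) end.
have ends_adj j ep : gadj c (ends j ep).1 (ends j ep).2 by case: ep => [[u i]|i] /=.
have epE j ep : edge_point sg gp (P j) ep = pairpt (ends j ep).1 (ends j ep).2.
  apply/ffunP => -[b x]; case: ep => [[u i]|i]; rewrite !ffunE /= sgE; case: ifP => _;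
    rewrite ?ffunE /gp ?ffunE //.
have zeroP j : is_zero sg gp c (P j).
  apply/forallP => -[ep w] /=; rewrite epE; have /andP[_ /forallP] := ends_adj j ep; exact.
pose Sg := [set j | ~~ surj sg (grad sg gp c (P j))].
have P_inj : injective P.
  move=> j j' PE; have [] // := X_inj j None j' None _.
  rewrite [X j None]surjective_pairing [X j' None]surjective_pairing !sgE; congr (_, _).
  by apply/ffunP => x; have /ffunP/(_ (None, x)) := PE; rewrite !ffunE.
have Sg_big : (ncopies <= #|Sg|)%N.
  have : (#|P @: ~: Sg| <= max_nonsingular ^ #|{: I}|)%N.
    apply: (@nonsingular_copies F r k sg rdegree gp c) => // Q /imsetP[j].
    by rewrite !inE negbK => sj ->; rewrite zeroP.
  rewrite card_imset // => le1; have := cardsC Sg; rewrite card_ord => E.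
  by move: ll; rewrite /max_copies; lia.
pose sub (a : 'I_ncopies) : 'I_l := enum_val (widen_ord Sg_big a).
have sub_inj : injective sub.
  by move=> a a' /enum_val_inj E; apply: val_inj; have := congr1 val E.
exists (g, [ffun a => P (sub a)]); apply/andP; split.
  apply/injectiveP => -[a ep] [a' ep'] /=; rewrite !ffunE -/sg -/gp !epE => /pairpt_inj H.
  have /andP[s1 _] := ends_adj (sub a) ep; have /andP[s2 _] := ends_adj (sub a') ep'.
  have {H} := H s1 s2; case: ep {s1} => [b|i]; case: ep' {s2} => [b'|i'] /=.
  - by case=> [[/X_inj[/sub_inj -> _] /g_inj -> //]|[/Xg]].
  - by case=> -[_ /esym/Xg].
  - by case=> -[E1 E2]; [have := Xg _ _ _ E2 | have := Xg _ _ _ E1].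
  - case=> -[/X_inj[/sub_inj -> E1] /X_inj[_ E2]] //.
    by case: E2 => ->.
apply/forallP => a; rewrite /= !ffunE -/sg -/gp zeroP /=.
by have := enum_valP (widen_ord Sg_big a); rewrite inE.
Qed.

(** The number of choices for the copies cancels exactly against the probability that their
    equations hold, since equations and unknowns are equally many. What remains is the choice of the
    roots and the gain [#|F| ^ ncopies] from singularity. *)
Lemma sum_bad : ((\sum_(c : Cs) #|[set x | bad c x]|) * #|F| ^ ncopies <=
   (2 * #|F| ^ #|coord|) ^ (k.+1 * r) * #|{: I}| ^ ncopies * #|{: Cs}|)%N.
Proof.
have -> : (\sum_(c : Cs) #|[set x | bad c x]| = \sum_(x : cfg) #|[set c | bad c x]|)%N.
  under eq_bigr do rewrite -sum1dep_card big_mkcond /=.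
  rewrite exchange_big; apply: eq_bigr => x _.
  by rewrite -big_mkcond sum1dep_card.
have F_gt0 : (0 < #|F|)%N by apply/card_gt0P; exists 0.
rewrite -(leq_pmul2r (_ : 0 < #|F| ^ (ncopies * #|{: K}|)))%N ?expn_gt0 ?F_gt0 //.
rewrite -mulnA -expnD.
apply: leq_trans (_ : \sum_(x : cfg) (#|{: I}| ^ ncopies * #|{: Cs}|) <= _)%N.
  rewrite big_distrl /=; apply: leq_sum => x _.
  have [inj|ninj] := boolP (injectiveb (fun q : 'I_ncopies * tedge =>
      edge_point (side x.1) (fun a => (x.1 a).2) (x.2 q.1) q.2)).
    have := @singular_copies F r k (side x.1) rdegree ncopies (fun a =>
      (x.1 a).2) x.2 (injectiveP _ inj) (leqnn _).
    apply: leq_trans; apply: leq_mul.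
      by apply: subset_leq_card; apply/subsetP => c; rewrite !inE => /andP[].
    by rewrite mulnDr muln1 addnC.
  by rewrite (_ : [set c | bad c x] = set0) ?cards0 //; apply/setP => c;
    rewrite !inE /bad (negPf ninj).
have cfgE : #|cfg| = ((2 * #|F| ^ #|coord|) ^ (k.+1 * r) * #|F| ^ (ncopies * #|{: I}|))%N.
  by rewrite card_prod !card_ffun !card_prod card_bool card_ffun !card_option !card_ord -expnM
    [(ncopies * _)%N]mulnC.
rewrite sum_nat_const (card_eq_var r k) cfgE.
by rewrite -!mulnA leq_mul2l [X in (X <= _)%N]mulnC -!mulnA leqnn orbT.
Qed.

(** At a fixed point the [k + 1] values are uniform, so the expected number of common zeros is known
    exactly. *)
Lemma sum_vanish : (0 < r)%N ->
  ((\sum_(c : Cs) #|[set p | vanish c p]|) * #|F| ^ k.+1 = #|F| ^ #|{: J}| * #|{: Cs}|)%N.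
Proof.
move=> r_gt0; have -> : (\sum_(c : Cs) #|[set p | vanish c p]|
  = \sum_p #|[set c : Cs | vanish c p]|)%N.
  under eq_bigr do rewrite -sum1dep_card big_mkcond /=.
  rewrite exchange_big; apply: eq_bigr => x _.
  by rewrite -big_mkcond sum1dep_card.
rewrite big_distrl /= -card_ffun -sum_nat_const; apply: eq_bigr => p _.
pose f (c : Cs) : {ffun U -> F} := [ffun w => pdat (c w) p None].
have fD c c' : f (c + c') = f c + f c' by apply/ffunP => w; rewrite !ffunE pdatD.
have f_surj y : exists c, f c = y.
  have H w : exists c : Cf, forall (q : unit) o, pdat c p o = (fun=> y w) o.
    apply: (@hermite_interpolation F J rdegree unit (fun=> p) (fun _ _ => y w)) => [[] []|] //.
    have : (0 < #|tedge|)%N by apply/card_gt0P; exists (inl (None, Ordinal r_gt0)).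
    by rewrite card_unit /rdegree ltnS leq_pmul2r // muln_gt0 /ncopies addnS => ->.
  have [c cP] := fin_all_exists H.
  by exists [ffun w => c w]; apply/ffunP => w; rewrite !ffunE (cP w tt).
have := @card_preim_homogeneous _ _ f [set [ffun=> 0]] _.
rewrite card_ffun card_option card_ord cards1 mul1n => <-.
  by congr (_ * _)%N; apply: eq_card => c; rewrite !inE; apply/forallP/eqP => [h|/ffunP h w];
    [apply/ffunP => w; rewrite !ffunE; apply/eqP | have := h w; rewrite !ffunE => ->].
move=> y y'; have [c fc] := f_surj (y' - y).
exists (fun x => x + c); first exact: addIr.
by move=> x fx; rewrite fD fx fc addrC subrK.
Qed.

Lemma good_graph : (0 < r)%N -> (min_field <= #|F|)%N ->
  exists c : Cs, (forall l, (max_copies <= l)%N -> ~ blowup_embedding (gadj c) k r l) /\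
    (#|F| ^ #|{: J}| <= 2 * #|F| ^ k.+1 * #|[set p | vanish c p]|)%N.
Proof.
move=> r_gt0; rewrite /min_field; set c1 := (_ ^ #|{: I}|)%N; set c2 := (_ * _)%N => FQ.
have F_gt0 : (0 < #|F|)%N by apply: leq_trans FQ.
have [/existsP[c /andP[/forallP nb big]]|] := boolP [exists c : Cs, [forall x, ~~ bad c x] &&
    (#|F| ^ #|{: J}| <= 2 * #|F| ^ k.+1 * #|[set p | vanish c p]|)%N].
  exists c; split=> // l ll emb; have [||x bx] := blowup_bad _ _ ll emb => //.
    by apply: leq_trans FQ; rewrite -/c1 leqW // leq_addr.
  by have := nb x; rewrite bx.
rewrite negb_exists => /forallP no; exfalso.
(* Either [c] has too few zeros and the first term suffices, or it has a bad configuration and the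
   last term covers the trivial bound on the number of zeros. *)
have each c : (2 * #|F| ^ k.+1 * #|[set p | vanish c p]| <=
    #|F| ^ #|{: J}| + 2 * #|F| ^ k.+1 * #|F| ^ #|{: J}| * #|[set x | bad c x]|)%N.
  have := no c; rewrite negb_and negb_forall -ltnNge => /orP[/existsP[x]|/ltnW h]; last first.
    by apply: leq_trans h _; apply: leq_addr.
  rewrite negbK => bx; apply: leq_trans (leq_addl _ _);
    rewrite -[X in (_ <= X)%N]mulnA leq_mul2l; apply/orP; right.
  apply: leq_trans (_ : #|F| ^ #|{: J}| <= _)%N; first by rewrite -card_ffun max_card.
  by rewrite leq_pmulr //; apply/card_gt0P; exists x; rewrite inE.
have : (\sum_(c : Cs) (2 * #|F| ^ k.+1 * #|[set p | vanish c p]|) <=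
   \sum_(c : Cs) (#|F| ^ #|{: J}| + 2 * #|F| ^ k.+1 * #|F| ^ #|{: J}| * #|[set x | bad c x]|))%N.
  by apply: leq_sum => c _; apply: each.
have sv := sum_vanish r_gt0; have sb := sum_bad.
rewrite big_split /= sum_nat_const -!big_distrr /=.
set q := #|F| in sv sb F_gt0 FQ *; set SV := (\sum_c #|[set p | vanish c p]|)%N in sv *.
set SB := (\sum_c #|[set x | bad c x]|)%N in sb *; set C := #|{: Cs}| in sv sb *.
have C_gt0 : (0 < C)%N by apply/card_gt0P; exists [ffun=> [ffun=> 0]].
rewrite -mulnA [(q ^ k.+1 * SV)%N]mulnC sv => H.
have qJ : (0 < q ^ #|{: J}|)%N by rewrite expn_gt0 F_gt0.
have H1 : (C <= 2 * q ^ k.+1 * SB)%N.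
  rewrite -(leq_pmul2l qJ); move: H; set a := (q ^ #|{: J}|)%N; set b := (q ^ k.+1)%N; nia.
have H2 : (q ^ ncopies <= c2 * q ^ (k.+1 + #|coord| * (k.+1 * r)))%N.
  rewrite -(leq_pmul2r C_gt0).
  apply: leq_trans (_ : 2 * q ^ k.+1 * (SB * q ^ ncopies) <= _)%N.
    by rewrite mulnA mulnC leq_mul2r H1 orbT.
  apply: leq_trans (leq_mul (leqnn _) sb) _.
  rewrite /c2 expnMn -expnM [in X in (_ <= X)%N]expnD (expnS 2).
  set a := (q ^ k.+1)%N; set b := (q ^ (_ * _))%N; set d := (2 ^ _)%N; set e := (_ ^ ncopies)%N.
  by apply: eq_leq; move: a b d e C {sv sb H H1 C_gt0} => a b d e C; ring.
move: H2; rewrite {1}/ncopies (_ : #|coord| * _ + k.+2 = (k.+1 + #|coord| * (k.+1 * r)).+1)%N;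
  last lia.
rewrite expnS leq_pmul2r ?expn_gt0 ?F_gt0 // leqNgt => /negP; apply.
by apply: leq_trans FQ; rewrite ltnS leq_addl.
Qed.
End RandomGraph.

Local Close Scope ring_scope.

(** * Copies of the blow-up *)

(** An inner vertex has a tree neighbour among the inner vertices and another among the roots, hence
    degree at least 2. *)
Lemma leaves_Dedge (k r : nat) (v : Dvert k r) : 0 < k -> 0 < r ->
  (v \in leaves (@Dedge k r)) = (if v is inr _ then true else false).
Proof.
move=> k_gt0 r_gt0; rewrite inE; case: v => [u|[u j]]; last first.
  apply/eqP; rewrite -(cards1 (inl u : Dvert k r)); apply: eq_card => -[u'|a]; rewrite !inE //=.
apply/negbTE; rewrite neq_ltn; apply/orP; right.
pose w : Dvert k r := inl (if u is Some _ then None else Some (Ordinal k_gt0)).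
pose w' : Dvert k r := inr (u, Ordinal r_gt0).
have -> : 1 = #|[set w; w']|.-1 by rewrite cards2.
rewrite cards2 /=; apply: leq_trans (_ : #|[set w; w']| <= _); first by rewrite cards2.
apply: subset_leq_card; apply/subsetP => x; rewrite !inE => /orP[] /eqP ->.
  by rewrite /w; case: (u).
by rewrite /w' /=; case: (u) => // i; apply: eqxx.
Qed.

Lemma contains_blowup (n k r l : nat) (g : {ffun 'I_n * 'I_n -> bool}) :
  0 < k -> 0 < r -> 0 < l -> simple_graph g ->
  contains (@Dblow k r l) g <-> blowup_embedding (fun x y => g (x, y)) k r l.
Proof.
move=> k_gt0 r_gt0 l_gt0 /andP[_ /forallP g_sym].
have gC x y : g (x, y) = g (y, x) by have /forallP/(_ y)/eqP := g_sym x.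
set lv := leaves (@Dedge k r).
have lvE v := @leaves_Dedge k r v k_gt0 r_gt0; rewrite -/lv in lvE.
have inner_ok (u : option 'I_k) (j : 'I_l) :
   ((inl u, j).1 \in lv) ==> (val (inl u : Dvert k r, j).2 == 0) by rewrite lvE.
have root_ok (a : option 'I_k * 'I_r) :
   ((inr a, Ordinal l_gt0).1 \in lv) ==> (val (inr a : Dvert k r, Ordinal l_gt0).2 == 0).
  by apply/implyP.
pose vi u j : blowup_vert lv l := exist _ (inl u : Dvert k r, j) (inner_ok u j).
pose vr a : blowup_vert lv l := exist _ (inr a : Dvert k r, Ordinal l_gt0) (root_ok a).
split.
  case/existsP=> f /andP[/injectiveP f_inj /forallP fe].
  have fE x y : Dblow x y -> g (f x, f y) by have /forallP/(_ y)/implyP := fe x.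
  exists (fun a => f (vr a)), (fun j u => f (vi u j)); split.
  - by move=> a b /f_inj /(congr1 val) [].
  - by move=> j u j' u' /f_inj /(congr1 val) [].
  - by move=> j u a /f_inj /(congr1 val).
  - move=> j u i; apply: fE; rewrite /Dblow /blowup_edge /= !lvE ?orbT ?andbT.
    by case: u => //= u; apply: eqxx.
  - by move=> j i; apply: fE; rewrite /Dblow /blowup_edge /= eqxx.
case=> gg [X [g_inj X_inj Xg eXg eXX]].
pose f (x : blowup_vert lv l) : 'I_n := match (val x).1 with inl u => X (val x).2 u | inr a =>
  gg a end.
apply/existsP; exists [ffun x => f x]; apply/andP; split.
  apply/injectiveP => -[[[u|a] j] hx] [[[u'|a'] j'] hy]; rewrite !ffunE /f /= => E.
  - by apply: val_inj => /=; case: (X_inj _ _ _ _ E) => -> ->.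
  - by have := Xg _ _ _ E.
  - by have := Xg _ _ _ (esym E).
  - apply: val_inj => /=; rewrite (g_inj _ _ E); congr (_, _); apply: val_inj.
    by move: (hx) (hy); rewrite /= !lvE /= => /eqP -> /eqP ->.
apply/forallP => -[[[u|[u i]] j] hx]; apply/forallP => -[[[u'|[u' i']] j'] hy]; apply/implyP;
  rewrite /Dblow /blowup_edge !ffunE /f /= -?/lv ?lvE /= ?orbT ?andbT ?orbF.
- by case: u hx => [i|] hx; case: u' hy => [i'|] hy //= /eqP ->; rewrite ?[g (X _ (Some _), _)]gC.
- by case: u hx => [w|] hx /eqP <-.
- by rewrite gC; case: u' hy => [w|] hy /eqP ->.
- by [].
Qed.

Lemma ex_upper (n k r l : nat) : 0 < r -> 0 < k -> 0 < l ->
  ex (@Dblow k r l) n ^ (k.+1 * r + k) <=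
    (4 ^ (k.+1 * r + k) * upper_const k r l) * n ^ (2 * (k.+1 * r + k) - k.+1).
Proof.
move=> r_gt0 k_gt0 l_gt0; rewrite /ex; set b := k.+1 * r + k.
elim/big_ind: _ => [|x y hx hy|g /andP[gs gn]].
- by rewrite exp0n // /b addn_gt0 k_gt0 orbT.
- by rewrite /maxn; case: ifP.
- apply: edges_upper => // /(contains_blowup k_gt0 r_gt0 l_gt0 gs); exact/negP.
Qed.

(** The graph is padded with isolated vertices up to [n]. Every vertex of the blow-up has a
    neighbour, so a copy in the padded graph avoids the padding. The factor 2 comes from counting
    ordered pairs. *)
Lemma ex_lower (V : finType) (e : rel V) (n k r l : nat) : 0 < r -> 0 < k -> 0 < l ->
  symmetric e -> irreflexive e -> #|V| <= n -> ~ blowup_embedding e k r l ->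
  #|[set p : V * V | e p.1 p.2]| <= 2 * ex (@Dblow k r l) n.
Proof.
move=> r_gt0 k_gt0 l_gt0 e_sym e_irr Vn no.
pose ph (v : V) : 'I_n := widen_ord Vn (enum_rank v).
have ph_inj : injective ph.
  by move=> v v' /(congr1 val)/= E; apply: enum_rank_inj; apply: val_inj.
pose g : {ffun 'I_n * 'I_n -> bool} :=
  [ffun p => [exists v, [exists v', [&& p.1 == ph v, p.2 == ph v' & e v v']]]].
have gP x y : reflect (exists v v', [/\ x = ph v, y = ph v' & e v v']) (g (x, y)).
  rewrite ffunE; apply: (iffP existsP) =>
    [[v /existsP[v' /and3P[/eqP ? /eqP ? ?]]]|[v [v' [-> -> h]]]].
    by exists v, v'.
  by exists v; apply/existsP; exists v'; rewrite !eqxx.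
have gs : simple_graph g.
  apply/andP; split; apply/forallP => x.
    by apply/gP => -[v [v' [-> /ph_inj ->]]]; rewrite e_irr.
  apply/forallP => y; apply/eqP; apply/gP/gP => -[v [v' [-> -> h]]]; exists v', v;
    by split=> //; rewrite e_sym.
have gn : ~~ contains (@Dblow k r l) g.
  apply/negP => /(contains_blowup k_gt0 r_gt0 l_gt0 gs) [gg [X [g_inj X_inj Xg eXg eXX]]].
  have [v0 _] : exists v0 : V, true.
    by have /gP[v] := eXg (Ordinal l_gt0) None (Ordinal r_gt0); exists v.
  pose ps (x : 'I_n) : V := odflt v0 [pick v | ph v == x].
  have phK : cancel ph ps.
    move=> v; rewrite /ps; case: pickP => [w /eqP/ph_inj //|/(_ v)]; by rewrite eqxx.
  have eps x y : g (x, y) -> e (ps x) (ps y) by case/gP => v [v' [-> -> h]]; rewrite !phK.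
  have XK j u : ph (ps (X j u)) = X j u.
    by have /gP[v [v' [-> _ _]]] := eXg j u (Ordinal r_gt0); rewrite phK.
  have gK a : ph (ps (gg a)) = gg a.
    by case: a => u i; have /gP[v [v' [_ -> _]]] := eXg (Ordinal l_gt0) u i; rewrite phK.
  apply: no; exists (fun a => ps (gg a)), (fun j u => ps (X j u)); split.
  - by move=> a b /(congr1 ph); rewrite !gK => /g_inj.
  - by move=> j u j' u' /(congr1 ph); rewrite !XK => /X_inj.
  - by move=> j u a /(congr1 ph); rewrite XK gK => /Xg.
  - by move=> j u i; apply/eps/eXg.
  - by move=> j i; apply/eps/eXX.
apply: leq_trans (_ : 2 * nedges g <= _); last first.
  by rewrite leq_mul2l /=; apply: (@leq_bigmax_cond _ _ (fun g => nedges g)); rewrite gs.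
rewrite -(nedges_double gs).
rewrite sum_card_section.
pose ph2 (p : V * V) := (ph p.1, ph p.2).
have ph2_inj : injective ph2.
  by move=> [a b] [c d] E; have /ph_inj/= -> := congr1 fst E; have /ph_inj/= -> := congr1 snd E.
rewrite -(card_imset _ ph2_inj); apply: subset_leq_card; apply/subsetP => -[x y].
case/imsetP=> -[v v']; rewrite inE /= => h [-> ->]; rewrite inE; apply/gP; by exists v, v'.
Qed.

(** * Conclusion *)

(** The random graph has [2 * #|F| ^ b] vertices, and each common zero, split into its two sides, is
    a distinct edge. *)
Lemma ex_lower_field (F : finFieldType) (n k r l : nat) (b := k.+1 * r + k) :
  0 < r -> 0 < k -> min_field r k <= #|F| -> max_copies r k <= l -> 2 * #|F| ^ b <= n ->
  #|F| ^ (2 * b - k.+1) <= 4 * ex (@Dblow k r l) n.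
Proof.
move=> r_gt0 k_gt0 qF ll qn.
have [c [no big]] := good_graph r_gt0 qF.
have l_gt0 : 0 < l by apply: leq_trans ll; rewrite /max_copies /ncopies !addnS.
have q_gt0 : 0 < #|F| by apply: leq_trans qF.
have cV : #|{: bool * {ffun coord r k -> F}}| <= n.
  by rewrite card_prod card_bool card_ffun card_coord.
have := @ex_lower _ (gadj c) n k r l r_gt0 k_gt0 l_gt0 (@gadj_sym F r k c) (@gadj_irr F r k c) cV
  (no l ll).
have le1 : #|[set p | vanish c p]| <= #|[set p : (bool * {ffun coord r k ->
  F}) * (bool * {ffun coord r k -> F}) | gadj c p.1 p.2]|.
  pose h (p : {ffun bool * coord r k -> F}) : (bool * {ffun coord r k ->
    F}) * (bool * {ffun coord r k -> F}) :=
    ((true, [ffun x => p (true, x)]), (false, [ffun x => p (false, x)])).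
  have hE p : pairpt (h p).1 (h p).2 = p.
    by apply/ffunP => -[[] x]; rewrite !ffunE.
  have h_inj : injective h by move=> p p' E; rewrite -(hE p) E hE.
  rewrite -(card_imset _ h_inj); apply: subset_leq_card; apply/subsetP => v /imsetP[p].
  by rewrite !inE => vp ->; rewrite /gadj hE vp.
move=> /(leq_trans le1) le2.
rewrite -(leq_pmul2r (_ : 0 < #|F| ^ k.+1)) ?expn_gt0 ?q_gt0 // -expnD subnK; last first.
  by rewrite /b; lia.
apply: leq_trans (_ : #|F| ^ #|{: bool * coord r k}| <= _).
  by rewrite card_prod card_bool card_coord.
apply: leq_trans big _; move: le2; set z := #|_|; set x := ex _ _; set y := _ ^ _; nia.
Qed.

Lemma ex_lower_nat (k r : nat) (b := k.+1 * r + k) : 0 < r -> 0 < k ->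
  exists N : nat, forall l n, max_copies r k <= l -> N <= n ->
    n ^ (2 * b - k.+1) <= 2 ^ (b.+1 * (2 * b - k.+1)) * 4 ^ b * ex (@Dblow k r l) n ^ b.
Proof.
move=> r_gt0 k_gt0; pose m := min_field r k.
have b_gt0 : 0 < b by rewrite addn_gt0 k_gt0 orbT.
have p_gt1 : 1 < 2 ^ b by rewrite -[1](expn0 2) ltn_exp2l.
(* The field has order [2 ^ kq], with [kq] largest such that [2 * (2 ^ kq) ^ b <= n]. This [N]
   forces [kq >= m], and maximality loses only the factor [2 ^ b.+1] against [n]. *)
exists (2 * (2 ^ b) ^ m) => l n ll nN.
have n2 : (2 ^ b) ^ m <= n %/ 2 by rewrite leq_divRL // mulnC.
pose kq := trunc_log (2 ^ b) (n %/ 2).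
have n2_gt0 : 0 < n %/ 2 by apply: leq_trans n2; rewrite !expn_gt0.
have mk : m <= kq by apply: trunc_log_max.
have /andP[lo hi] := trunc_log_bounds p_gt1 n2_gt0; rewrite -/kq in lo hi.
have kq_gt0 : 0 < kq by apply: leq_trans mk.
have [F _ Fq] := PrimePowerField (isT : prime 2) kq_gt0.
have qE : (2 ^ b) ^ kq = #|F| ^ b by rewrite Fq -!expnM mulnC.
have qF : min_field r k <= #|F| by rewrite Fq; apply: leq_trans mk (ltnW (ltn_expl _ _)).
have qn : 2 * #|F| ^ b <= n by rewrite -qE mulnC -leq_divRL.
have H := ex_lower_field r_gt0 k_gt0 qF ll qn.
have nq : n <= 2 ^ b.+1 * #|F| ^ b.
  move: hi; rewrite expnS qE ltn_divLR // => /ltnW h; apply: leq_trans h _.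
  by rewrite expnS mulnC mulnA.
apply: leq_trans (leq_expl (2 * b - k.+1) nq) _.
rewrite expnMn -expnM -mulnA leq_mul2l; apply/orP; right.
by rewrite -expnM mulnC expnM -expnMn leq_expl.
Qed.

(* Passage to real exponents *)
Delimit Scope R_scope with R.

Lemma pow_le_pow (x y : R) (b : nat) : 0 < b -> (0 <= y -> x ^ b <= y ^ b -> x <= y)%R.
Proof.
move=> b_gt0 y0 xy; have [//|yx] := Rle_or_lt x y; exfalso.
have lt m : (y ^ m.+1 < x ^ m.+1)%R.
  elim: m => [|m IH]; first by rewrite !pow_1.
  apply: (Rle_lt_trans _ (y * x ^ m.+1)%R).
    by apply: Rmult_le_compat_l => //; apply: Rlt_le.
  by apply: Rmult_lt_compat_r => //; apply: pow_lt; apply: Rle_lt_trans yx.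
by have := lt b.-1; rewrite prednK // => /Rlt_not_le.
Qed.

Lemma INR_leq (m n : nat) : m <= n -> (INR m <= INR n)%R.
Proof. by move=> /ssrnat.leP; apply: le_INR. Qed.

Lemma INR_expn (m n : nat) : INR (m ^ n) = (INR m ^ n)%R.
Proof. by elim: n => // n IH; rewrite expnS mult_INR IH. Qed.

Lemma Rpower_root (n b t : nat) : 0 < n -> 0 < b -> t <= 2 * b ->
  (Rpower (INR n) (2 - INR t / INR b) ^ b)%R = INR (n ^ (2 * b - t)).
Proof.
move=> n_gt0 b_gt0 tb.
have nR : (0 < INR n)%R by apply: lt_0_INR; apply/ssrnat.ltP.
have bR : (0 < INR b)%R by apply: lt_0_INR; apply/ssrnat.ltP.
rewrite -Rpower_pow; last exact: exp_pos.
rewrite Rpower_mult INR_expn -Rpower_pow // minus_INR; last exact/ssrnat.leP.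
rewrite mult_INR; congr Rpower.
by rewrite Rmult_minus_distr_r /Rdiv Rmult_assoc Rinv_l ?Rmult_1_r //; apply: Rgt_not_eq.
Qed.

(** Taking [b]-th roots; the constants may stay as they are because a positive integer is at most
    its [b]-th power. *)
Lemma root_bounds (x n b t C c : nat) : 0 < n -> 0 < b -> 0 < C -> 0 < c -> t <= 2 * b ->
  x ^ b <= C * n ^ (2 * b - t) -> n ^ (2 * b - t) <= c * x ^ b ->
  (/ INR c * Rpower (INR n) (2 - INR t / INR b) <= INR x
     <= INR C * Rpower (INR n) (2 - INR t / INR b))%R.
Proof.
move=> n_gt0 b_gt0 C_gt0 c_gt0 tb up lo.
have self (m : nat) : 0 < m -> m <= m ^ b by move=> m0; rewrite -{1}[m]expn1 leq_pexp2l.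
have := Rpower_root n_gt0 b_gt0 tb; set y := Rpower _ _ => yE.
have y0 : (0 < y)%R by apply: exp_pos.
have cR : (0 < INR c)%R by apply: lt_0_INR; apply/ssrnat.ltP.
have x0 : (0 <= INR x)%R by apply: pos_INR.
split.
  apply: (Rmult_le_reg_l (INR c)) => //; rewrite -Rmult_assoc Rinv_r; last exact: Rgt_not_eq.
  rewrite Rmult_1_l; apply: (@pow_le_pow _ _ b) => //; first by apply: Rmult_le_pos => //;
    apply: Rlt_le.
  rewrite yE Rpow_mult_distr -!INR_expn -mult_INR; apply: INR_leq.
  by apply: leq_trans lo _; apply: leq_mul (self _ c_gt0) _.
apply: (@pow_le_pow _ _ b) => //.
  by apply: Rmult_le_pos; [apply: pos_INR | apply: Rlt_le].
rewrite Rpow_mult_distr yE -!INR_expn -mult_INR; apply: INR_leq.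
by apply: leq_trans up _; apply: leq_mul (self _ C_gt0) _.
Qed.

Theorem theorem3p1 (s t : nat) (hs : (2 <= s)%nat) (ht : (2 <= t)%nat) :
  exists l0 : nat, forall l : nat, (l0 <= l)%nat ->
    exists (c C : R) (N : nat), (0 < c)%R /\ (0 < C)%R /\
      forall n : nat, (N <= n)%nat ->
        let a := (2 - INR t / INR (s * t - 1)%nat)%R in
        (c * Rpower (INR n) a <= INR (ex (@Dblow (t - 1)%nat (s - 1)%nat l) n)
         <= C * Rpower (INR n) a)%R.
Proof.
pose k := t - 1; pose r := s - 1; pose b := k.+1 * r + k.
have k_gt0 : 0 < k by rewrite subn_gt0.
have r_gt0 : 0 < r by rewrite subn_gt0.
have tE : t = k.+1 by rewrite /k; lia.
(* The number of edges of the tree is the denominator of the exponent. *)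
have bE : s * t - 1 = b by rewrite /b /k /r; nia.
have b_gt0 : 0 < b by rewrite addn_gt0 k_gt0 orbT.
have tb : t <= 2 * b by rewrite tE /b; nia.
exists (max_copies r k) => l ll.
have l_gt0 : 0 < l by apply: leq_trans ll; rewrite /max_copies /ncopies !addnS.
have [N lower] := ex_lower_nat r_gt0 k_gt0.
pose C := 4 ^ b * upper_const k r l; pose c := 2 ^ (b.+1 * (2 * b - k.+1)) * 4 ^ b.
have C_gt0 : 0 < C by rewrite muln_gt0 expn_gt0 /upper_const addnAC addnS.
have c_gt0 : 0 < c by rewrite muln_gt0 !expn_gt0.
exists (/ INR c)%R, (INR C), N.+1; split; first by apply/Rinv_0_lt_compat/lt_0_INR/ssrnat.ltP.
split; first by apply/lt_0_INR/ssrnat.ltP.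
move=> n nN; rewrite /= bE -/k -/r; apply: root_bounds => //.
- by apply: leq_trans nN.
- by rewrite tE; apply: ex_upper.
- by rewrite tE; apply: lower => //; apply: ltnW.
Qed.
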